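(* (Digging.) Fix an arbitrary monoid of weights $\Omega$ and an arbitrary measurable map $m:\Omega\to[0,\infty]$, and work in the interaction-graphs model described in the context (measure space $\mathbf{X}=\mathbb{R}\times[0,1]^{\mathbb{N}}$, microcosm $\mathfrak{ll}_\rho$). For every conduct $\mathbf{A}$, the conduct $!\mathbf{A}\multimap\,!!\mathbf{A}$ contains a project. Here $!\mathbf{A}$ and $!!\mathbf{A}$ are taken on disjoint supports, as described in the context.
   Context: Setting. $\mathbf{X}=\mathbb{R}\times[0,1]^{\mathbb{N}}$ with its Borel algebra and Lebesgue (product) measure. Points of $\mathbf{X}$ are written $(a,s)$ with $a\in\mathbb{R}$ and $s$ a sequence in $[0,1]$. We write $x\bullet s$, resp. $(x_1,\dots,x_k)\bullet s$, for the sequence obtained by prepending $x$, resp. $x_1,\dots,x_k$, to $s$. Points of $\mathbf{X}\times[0,1]$ are written $(a,s,e)$. Microcosm. Fix a measure-preserving bijection $\rho:[0,1]^2\to[0,1]$. The microcosm $\mathfrak{ll}_\rho$ is the monoid, under composition, of maps $\mathbf{X}\times[0,1]\to\mathbf{X}\times[0,1]$ generated by: - the affine maps $(x,s,e)\mapsto(\alpha x+\lambda,s,e)$; - the finite permutations of the coordinates of $s$, i.e. $(x,s,e)\mapsto(x,\sigma(s),e)$; - $D_\rho:(a,(x,y)\bullet s,e)\mapsto(a,\rho(x,y)\bullet s,e)$ and its inverse; - the exchange $\mathtt{xch}:(a,x\bullet s,e)\mapsto(a,e\bullet s,x)$. Graphings. A thick $\Omega$-weighted $\mathfrak{ll}_\rho$-graphing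 $G$ with support a measurable set $S^G\subseteq\mathbf{X}$ and dialect $[0,1]$ is a set of edges $E^G$. Each edge $e$ has: - a measurable source $s^G(e)\subseteq S^G\times[0,1]$; - a realiser $\phi_e\in\mathfrak{ll}_\rho$ with $\phi_e(s^G(e))\subseteq S^G\times[0,1]$; - a weight $\omega^G(e)\in\Omega$. Two graphings are variants if one is obtained from the other by conjugating all realisers by $\mathrm{Id}_{\mathbf{X}}\times\theta$, for $\theta$ a Borel automorphism of $[0,1]$. Paths and execution. A path is a sequence of edges whose successive composite realisers, applied to the first source, keep sets of positive measure. Its realiser is the composite, its weight is the product of the weights, and its source is the maximal domain. Alternating paths between $F$ and $G$ alternate edges of $F$ and $G$. When an edge of one graphing is used, the dialect coordinate of the other graphing is left unchanged; so the dialect of the execution is the product of the two dialects. If $S^F=V\sqcup C$ and $S^G=C\sqcup W$, the execution $F::G$ is the graphing of support $V\sqcup W$ whose edges are the alternating paths, each restricted to the points lying outside $C$ whose image also lies outside $C$. Projects and orthogonality. A measurement $[\![F,G]\!]\in[0,\infty]$ of alternating cycles between $F$ and $G$ is determined by $m$. For discrete graphings it is the sum of $m(\omega(\pi))$ over alternating cycles $\pi$; in general it is an integral of $m(\omega(\pi))$ over the supports of the cycles. A project is $\mathfrak{a}=(a,A)$ with $a\in[0,\infty]$ and $A=\sum_{i\in I}\alpha_iA_i$ a finite formal weighted sum, with real coefficients, of graphings of the same support. We write $\mathbf{1}_A=\sum_i\alpha_i$. Execution and measurement extend bilinearly to such sums. - Projects $(a,A)$ and $(b,B)$ of equal support are orthogonal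 if $a\mathbf{1}_B+b\mathbf{1}_A+[\![A,B]\!]\notin\{0,\infty\}$. - $T^{\perp}$ is the set of projects orthogonal to all elements of $T$. - A conduct of support $V$ is a set of projects of support $V$ with $\mathbf{A}=\mathbf{A}^{\perp\perp}$. - The execution of projects is $(a,A)::(b,B)=(a\mathbf{1}_B+b\mathbf{1}_A+[\![A,B]\!],A::B)$. Connectives. For conducts $\mathbf{A},\mathbf{B}$ of disjoint supports $V,W$, $\mathbf{A}\multimap\mathbf{B}=\{\mathfrak{f}\text{ of support }V\cup W:\forall\mathfrak{a}\in\mathbf{A},\ \mathfrak{f}::\mathfrak{a}\in\mathbf{B}\}$. As usual, when a formula is interpreted, its conducts are replaced by delocated copies with disjoint supports. A delocated copy is the image of all graphings under a Borel automorphism of $\mathbf{X}$ acting on supports. Exponential. A project $(a,A)$ is balanced if $a=0$ and its dialect is $[0,1]$. Let $\mathcal{B}:\mathbf{X}\times[0,1]\to\mathbf{X}$ be the map $(a,s,d)\mapsto(a,d\bullet s)$. For a balanced project $(0,A)$, set $!A=\mathcal{B}^2(A\times\mathrm{Id}_{[0,1]})$. This is the dialect-free graphing obtained by pushing the dialect of $A$, together with a fresh copy of $[0,1]$, into the first two coordinates of the Hilbert-cube sequence. Then $!(0,A)=(0,!A)$. For a conduct $\mathbf{A}$, $!\mathbf{A}=\{\,!\mathfrak{a}:\mathfrak{a}\in\mathbf{A}\text{ balanced}\}^{\perp\perp}$.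
   Formalization: The delocating Borel automorphisms are assumed non-singular (the claim fails if a support is sent to a null set), affine maps have nonzero slope, and the project's realisers lie in the monoid generated by the microcosm and the two delocations (the microcosm itself when they belong to it). *)

(* Defs.v *)
From HB Require Import structures.
From mathcomp Require Import all_boot all_order all_algebra.
From mathcomp Require Import all_classical all_reals all_analysis.
From mathcomp Require Import measurable_realfun.

Set Implicit Arguments.
Unset Strict Implicit.
Unset Printing Implicit Defensive.

Import Order.TTheory GRing.Theory Num.Theory.

Local Open Scope classical_set_scope.
Local Open Scope ring_scope.

(** ** The unit interval [0, 1], with its Borel sets and Lebesgue measure *)

Definition unit_itv (R : realType) := {x : R | 0 <= x <= 1}.

Section unit_interval.
Context {R : realType}.

Let unit_itv0 : 0 <= (0 : R) <= 1. Proof. by rewrite lexx ler01. Qed.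

HB.instance Definition _ := Choice.on (unit_itv R).
HB.instance Definition _ :=
  isPointed.Build (unit_itv R) (exist _ 0 unit_itv0 : unit_itv R).

Definition unit_val (x : unit_itv R) : measurableTypeR R := sval x.

End unit_interval.

(* The trace of the Borel sets of R. *)
Notation I01 R := (g_sigma_algebra_preimageType (@unit_val R)).

Section unit_measure.
Context {R : realType}.
Implicit Type A : set (I01 R).

Definition leb01 A : \bar R := lebesgue_measure (@unit_val R @` A).

Lemma unit_val_inj : injective (@unit_val R).
Proof. exact: val_inj. Qed.

Lemma unit_valT : @unit_val R @` setT = `[0, 1]%classic.
Proof.
apply/seteqP; split=> [_ [x _ <-]|x].
  by rewrite /= in_itv/=; exact: (svalP x).
by rewrite /= in_itv/= => x01; exists (exist _ x x01).
Qed.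

Lemma measurable_unit_val_image A :
  measurable A -> measurable (@unit_val R @` A).
Proof.
move=> [B mB <-]; rewrite setTI.
rewrite (_ : _ @` _ = B `&` `[0, 1]%classic); first exact: measurableI.
rewrite -unit_valT; apply/seteqP; split=> [_ [x Bx <-]|x [Bx [y _ yx]]].
  by split=> //; exists x.
by exists y => //; rewrite /preimage/= yx.
Qed.

Let leb01_0 : leb01 set0 = 0%E.
Proof. by rewrite /leb01 image_set0 measure0. Qed.

Let leb01_ge0 A : (0 <= leb01 A)%E. Proof. exact: measure_ge0. Qed.

Let leb01_sigma_additive : semi_sigma_additive leb01.
Proof.
move=> F mF tF _; rewrite /leb01 image_bigcup.
apply: measure_semi_sigma_additive.
- by move=> n; exact: measurable_unit_val_image.
- apply/trivIsetP => i j _ _ ij; apply/seteqP; split=> // x [[y Fy <-] [z Fz]].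
  move=> /unit_val_inj zy; move: Fz; rewrite zy => Fz.
  by move/trivIsetP : tF => /(_ i j Logic.I Logic.I ij) /seteqP[+ _] => /(_ y);
    apply.
- by apply: bigcupT_measurable => n; exact: measurable_unit_val_image.
Qed.

HB.instance Definition _ := isMeasure.Build _ _ _ leb01
  leb01_0 leb01_ge0 leb01_sigma_additive.

Let leb01_setT : leb01 setT = 1%E.
Proof.
by rewrite /leb01 unit_valT lebesgue_measure_itv/= lte_fin ltr01 sube0.
Qed.

HB.instance Definition _ :=
  Measure_isProbability.Build _ _ _ leb01 leb01_setT.

End unit_measure.

(** ** The Hilbert cube and the space X = R x [0, 1]^N *)

Definition cylinders (R : realType) : set (set (nat -> I01 R)) :=
  [set C | exists i (B : set (I01 R)), measurable B /\ C = [set s | B (s i)]].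

(* The product sigma-algebra of [0, 1]^N, which is also its Borel algebra. *)
Notation cube R := (g_sigma_algebraType (@cylinders R)).

Notation Xspace R := (measurableTypeR R * cube R)%type.

(* The Lebesgue measure of [0, 1]^N, characterised by its values on the boxes
   that constrain finitely many coordinates. *)
Definition cube_lebesgue (R : realType) (nu : probability (cube R) R) :=
  forall n (B : nat -> set (I01 R)), (forall i, measurable (B i)) ->
    nu [set s : cube R | forall i, (i < n)%N -> B i (s i)] =
    (\prod_(i < n) leb01 (B i))%E.

Section space.
Context {R : realType}.
Implicit Types (x : Xspace R) (s : cube R) (y : Xspace R * I01 R).

Definition scons (d : I01 R) s : cube R := fun i => if i is j.+1 then s j else d.

Definition sdrop (n : nat) s : cube R := fun i => s (n + i)%N.

Definition mu_X (nu : probability (cube R) R) : set (Xspace R) -> \bar R :=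
  (lebesgue_measure \x nu)%E.

(* The space on which two graphings, each with its own dialect, interact:
   points are (x, d, d') with d (resp. d') the dialect of the first (resp.
   second) graphing. *)
Definition mu_XII (nu : probability (cube R) R) :
    set (Xspace R * I01 R * I01 R) -> \bar R :=
  (lebesgue_measure \x nu \x leb01 \x leb01)%E.

End space.

(** ** The microcosm *)

Record square_iso (R : realType) := SquareIso {
  sq_map :> I01 R * I01 R -> I01 R;
  sq_inv : I01 R -> I01 R * I01 R;
  sq_mapK : cancel sq_map sq_inv;
  sq_invK : cancel sq_inv sq_map;
  measurable_sq_map : measurable_fun setT sq_map;
  measurable_sq_inv : measurable_fun setT sq_inv;
  sq_map_preserving : forall B, measurable B ->
    (leb01 \x leb01)%E (sq_map @^-1` B) = leb01 B }.

(* Existence of the Lebesgue measure of the cube: iterating the inverse of rho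
   turns a uniform variable into a sequence of independent uniform variables. *)
Section cube_lebesgue_exists.
Context {R : realType} (rho : square_iso R).

Definition unroll (x : I01 R) : cube R :=
  fun i => (sq_inv rho (iter i (fun x => (sq_inv rho x).2) x)).1.

Let box n (B : nat -> set (I01 R)) : set (I01 R) :=
  [set x | forall i, (i < n)%N -> B i (unroll x i)].

Let unrollS x i : unroll x i.+1 = unroll (sq_inv rho x).2 i.
Proof. by rewrite /unroll iterSr. Qed.

Let boxS n B : box n.+1 B =
  sq_inv rho @^-1` (B 0%N `*` box n (fun i => B i.+1)).
Proof.
apply/seteqP; split=> x /=.
  by move=> h; split=> [|i ni]; [exact: (h 0%N)|rewrite -unrollS; exact: h].
by move=> [h0 h] [_|i ni]; [exact: h0|rewrite unrollS; exact: h].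
Qed.

Let measurable_box n B : (forall i, measurable (B i)) -> measurable (box n B).
Proof.
elim: n B => [|n IH] B mB.
  by rewrite (_ : box 0 B = setT)//; apply/seteqP; split.
rewrite boxS -[X in measurable X]setTI.
by apply: measurable_sq_inv => //; apply: measurableX => //; exact: IH.
Qed.

Let leb01_sq_inv (D : set (I01 R * I01 R)) : measurable D ->
  leb01 (sq_inv rho @^-1` D) = (leb01 \x leb01)%E D.
Proof.
move=> mD; rewrite -(sq_map_preserving rho); last first.
  by rewrite -[X in measurable X]setTI; exact: measurable_sq_inv.
by rewrite -comp_preimage (_ : _ \o _ = id)//; apply/funext => x; exact: sq_mapK.
Qed.

Let leb01_box n B : (forall i, measurable (B i)) ->
  (leb01 (box n B) = \prod_(i < n) leb01 (B i))%E.
Proof.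
elim: n B => [|n IH] B mB.
  rewrite big_ord0 (_ : box 0 B = setT); first exact: probability_setT.
  by apply/seteqP; split.
rewrite boxS leb01_sq_inv; last by apply: measurableX => //; exact: measurable_box.
rewrite product_measure1E//; last exact: measurable_box.
by rewrite big_ord_recl -(IH (fun i => B i.+1)).
Qed.

Let measurable_unroll : measurable_fun setT unroll.
Proof.
apply: (@measurability _ _ _ (cube R) setT unroll (@cylinders R)) => //.
move=> _ [_ [i [B [mB ->]]] <-].
pose C j := if j == i then B else setT.
have -> : setT `&` unroll @^-1` [set s | B (s i)] = box i.+1 C.
  apply/seteqP; split=> x; rewrite /C.
    by move=> [_ Bx] j _; case: eqP => [->|].
  by move=> /(_ i (leqnn _)); rewrite eqxx.
by apply: measurable_box => j; rewrite /C; case: eqP.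
Qed.

HB.instance Definition _ :=
  isMeasurableFun.Build _ _ _ _ unroll measurable_unroll.

Lemma cube_lebesgue_exists : exists nu : probability (cube R) R,
  cube_lebesgue nu.
Proof. by exists (distribution leb01 unroll) => n B /(leb01_box n). Qed.

End cube_lebesgue_exists.

Inductive monoid_gen (T : Type) (G : set (T -> T)) : (T -> T) -> Prop :=
| monoid_gen_id : monoid_gen G idfun
| monoid_gen_in f : G f -> monoid_gen G f
| monoid_gen_comp f g : monoid_gen G f -> monoid_gen G g ->
    monoid_gen G (f \o g).

Section microcosm.
Context {R : realType} (rho : square_iso R).
Local Notation Y := (Xspace R * I01 R)%type.
Implicit Type y : Y.

Definition affine_map (alpha lambda : R) y : Y :=
  ((alpha * y.1.1 + lambda, y.1.2), y.2).

Definition perm_map (sigma : nat -> nat) y : Y :=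
  ((y.1.1, y.1.2 \o sigma), y.2).

Definition D_map y : Y :=
  let s := y.1.2 in ((y.1.1, scons (rho (s 0%N, s 1%N)) (sdrop 2 s)), y.2).

Definition D_inv y : Y :=
  let s := y.1.2 in let d := sq_inv rho (s 0%N) in
  ((y.1.1, scons d.1 (scons d.2 (sdrop 1 s))), y.2).

Definition xch_map y : Y :=
  ((y.1.1, scons y.2 (sdrop 1 y.1.2)), y.1.2 0%N).

(* alpha != 0: the elements of a microcosm are non-singular. *)
Inductive ll_generator : (Y -> Y) -> Prop :=
| ll_affine alpha lambda : alpha != 0 -> ll_generator (affine_map alpha lambda)
| ll_perm sigma : bijective sigma ->
    (exists n, forall i, (n <= i)%N -> sigma i = i) ->
    ll_generator (perm_map sigma)
| ll_D : ll_generator D_map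
| ll_Dinv : ll_generator D_inv
| ll_xch : ll_generator xch_map.

Definition ll : set (Y -> Y) := monoid_gen ll_generator.

End microcosm.

(** ** Graphings *)

Section graphings.
Context {R : realType} {Omega : Type}.
Local Notation Y := (Xspace R * I01 R)%type.

Record pregraphing := Pregraphing {
  gsupport : set (Xspace R);
  edge : choiceType;
  source : edge -> set Y;
  realiser : edge -> Y -> Y;
  weight : edge -> Omega }.

Definition is_graphing (M : set (Y -> Y)) (G : pregraphing) :=
  measurable (gsupport G) /\
  forall e : edge G,
    [/\ measurable (source e), source e `<=` gsupport G `*` setT,
        M (@realiser G e) &
        @realiser G e @` source e `<=` gsupport G `*` setT].

Record preproject := Preproject {
  psupport : set (Xspace R);
  wager : \bar R;
  slice : finType;
  coef : slice -> R;
  graph : slice -> pregraphing }.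

Definition is_project (M : set (Y -> Y)) (a : preproject) :=
  [/\ measurable (psupport a), (0 <= wager a)%E &
      forall i : slice a,
        is_graphing M (graph i) /\ gsupport (graph i) = psupport a].

Definition total_coef (a : preproject) : R := \sum_(i : slice a) coef i.

End graphings.
Arguments pregraphing : clear implicits.
Arguments preproject : clear implicits.
Arguments realiser {R Omega} p e _.
Arguments weight {R Omega} p e.

(** ** Alternating paths, execution and measurement *)

Section interaction.
Context {R : realType} {Omega : Type} (one : Omega) (mul : Monoid.law one).
Context (nu : probability (cube R) R).
Local Notation Y := (Xspace R * I01 R)%type.
Local Notation Z := (Xspace R * I01 R * I01 R)%type.

Section paths.
Context (F G : pregraphing R Omega).
Local Notation E := (edge F + edge G)%type.
Implicit Types (e : E) (p : seq E) (z : Z).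

Definition step_source e : set Z :=
  match e with
  | inl e => [set z | source e z.1]
  | inr e => [set z | source e (z.1.1, z.2)]
  end.

Definition step e z : Z :=
  match e with
  | inl e => (realiser F e z.1, z.2)
  | inr e => let w := realiser G e (z.1.1, z.2) in ((w.1, z.1.2), w.2)
  end.

Definition step_weight e : Omega :=
  match e with inl e => weight F e | inr e => weight G e end.

Definition alternate : rel E := fun e e' => is_inl e != is_inl e'.

Definition path_map p z : Z := foldl (fun z e => step e z) z p.

Fixpoint path_source p : set Z :=
  if p is e :: p' then step_source e `&` step e @^-1` path_source p' else setT.

Definition path_weight p : Omega := \big[mul/one]_(e <- p) step_weight e.

(* A is the set of points reached by the edges already taken. *)
Fixpoint reaching (A : set Z) p : Prop :=
  if p is e :: p' then
    (0 < mu_XII nu (A `&` step_source e))%E /\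
    reaching (step e @` (A `&` step_source e)) p'
  else True.

Definition alternating_path p :=
  [/\ p != [::], sorted alternate p & reaching setT p].

(* Cycles along which sets of positive measure are not kept need not be
   excluded: their support is negligible. *)
Definition alternating_cycle p := p != [::] /\ cycle alternate p.

Definition cycle_support p : set Z :=
  [set z | path_source p z /\ path_map p z = z].

Definition rotations p : seq (seq E) :=
  undup [seq rot i p | i <- iota 0 (size p)].

Definition cut : set (Xspace R) := gsupport F `&` gsupport G.

Definition exec_source p : set Z :=
  [set z | [/\ path_source p z, ~ cut z.1.1 & ~ cut (path_map p z).1.1]].

End paths.

Section execution.
Context (rho : square_iso R) (F G : pregraphing R Omega).

(* The dialect [0, 1]^2 of an execution is identified with [0, 1] along rho. *)
Definition merge_dialects (z : Z) : Y := (z.1.1, rho (z.1.2, z.2)).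

Definition split_dialects (y : Y) : Z :=
  let d := sq_inv rho y.2 in ((y.1, d.1), d.2).

(* An alternating path whose restriction is negligible yields no edge. *)
Definition exec : pregraphing R Omega := {|
  gsupport := (gsupport F `\` cut F G) `|` (gsupport G `\` cut F G);
  edge := {p : seq (edge F + edge G) |
    `[< alternating_path p /\ (0 < mu_XII nu (exec_source p))%E >]};
  source := fun p => split_dialects @^-1` exec_source (sval p);
  realiser := fun p => merge_dialects \o path_map (sval p) \o split_dialects;
  weight := fun p => path_weight (sval p) |}.

End execution.

Section measurement.
Context (m : Omega -> \bar R).

(* Each alternating cycle pi contributes the integral of m (omega pi) over its
   support, the set of points to which pi returns.  The sum runs over the
   cycles up to cyclic permutation.  The integral is averaged over the rotations of a cycle: their supports are
   images of one another, so that the average is the common value when the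
   realisers preserve the measure and m (u v) = m (v u). *)
Definition measurement (F G : pregraphing R Omega) : \bar R :=
  (\esum_(p in [set p : seq (edge F + edge G) | alternating_cycle p])
    ((size (rotations p))%:R^-1)%:E *
    \int[mu_XII nu]_(z in cycle_support p) m (path_weight p))%E.

(* Extended values are taken in R + {oo} with a single, absorbing, infinity. *)
Definition absorb (v : \bar R) : \bar R :=
  if v \is a fin_num then v else +oo%E.

Definition interaction (a b : preproject R Omega) : \bar R :=
  absorb (wager a * (total_coef b)%:E + wager b * (total_coef a)%:E +
    \sum_(i : slice a) \sum_(j : slice b)
      (coef i * coef j)%:E * measurement (graph i) (graph j))%E.

Definition orthogonal_projects (a b : preproject R Omega) :=
  [/\ psupport a = psupport b, interaction a b <> 0%E &
      interaction a b <> +oo%E].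

Context (rho : square_iso R).

Definition exec_project (a b : preproject R Omega) : preproject R Omega := {|
  psupport := (psupport a `\` psupport b) `|` (psupport b `\` psupport a);
  wager := interaction a b;
  slice := (slice a * slice b)%type;
  coef := fun ij => coef ij.1 * coef ij.2;
  graph := fun ij => exec rho (graph ij.1) (graph ij.2) |}.

(** ** Conducts and connectives *)

(* Not a set in the sense of classical_sets: the universe of that type is below
   the one of preproject. *)
Local Notation projects := (preproject R Omega -> Prop).

Definition orth (V : set (Xspace R)) (T : projects) : projects :=
  fun a => [/\ is_project (ll rho) a, psupport a = V &
               forall t, T t -> orthogonal_projects a t].

Definition conduct (V : set (Xspace R)) (A : projects) :=
  [/\ measurable V,
      forall a, A a -> is_project (ll rho) a /\ psupport a = V &
      forall a, A a <-> orth V (orth V A) a].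

(* M is the microcosm in which the realisers of the elements are taken. *)
Definition lollipop (M : set (Y -> Y)) (V W : set (Xspace R))
    (A B : projects) : projects :=
  fun f => [/\ is_project M f, psupport f = V `|` W &
               forall a, A a -> B (exec_project f a)].

End measurement.

End interaction.

(** ** Exponential *)

Section exponential.
Context {R : realType} {Omega : Type}.
Local Notation Y := (Xspace R * I01 R)%type.

Definition push (y : Y) : Xspace R := (y.1.1, scons y.2 y.1.2).

Definition pop (x : Xspace R) : Y := ((x.1, sdrop 1 x.2), x.2 0%N).

(* (a, d' . d . s) is decoded as ((a, s), d) with d the former dialect, the
   fresh copy d' of [0, 1] being forgotten. *)
Definition pop2 (x : Xspace R) : Y := pop (pop x).1.

Definition bang_support (V : set (Xspace R)) : set (Xspace R) :=
  [set x | V (pop2 x).1].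

(* The resulting graphing is dialect-free, i.e. it ignores its own dialect. *)
Definition bang_graphing (G : pregraphing R Omega) : pregraphing R Omega := {|
  gsupport := bang_support (gsupport G);
  edge := edge G;
  source := fun e => [set y | source e (pop2 y.1)];
  realiser := fun e y =>
    (push (push (realiser G e (pop2 y.1)), (pop y.1).2), y.2);
  weight := weight G |}.

Definition bang_project (a : preproject R Omega) : preproject R Omega := {|
  psupport := bang_support (psupport a);
  wager := 0%E;
  slice := slice a;
  coef := @coef _ _ a;
  graph := fun i => bang_graphing (graph i) |}.

(* All dialects are [0, 1] here, so only the wager is constrained. *)
Definition balanced (a : preproject R Omega) := wager a = 0%E.

Context (one : Omega) (mul : Monoid.law one) (nu : probability (cube R) R).
Context (m : Omega -> \bar R) (rho : square_iso R).

Local Notation projects := (preproject R Omega -> Prop).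

Definition bang (V : set (Xspace R)) (A : projects) : projects :=
  let W := bang_support V in
  orth mul nu m rho W
    (orth mul nu m rho W
      (fun b => exists a, [/\ A a, balanced a & b = bang_project a])).

End exponential.

(** ** Delocation *)

Record borel_aut (R : realType) := BorelAut {
  aut_map :> Xspace R -> Xspace R;
  aut_inv : Xspace R -> Xspace R;
  aut_mapK : cancel aut_map aut_inv;
  aut_invK : cancel aut_inv aut_map;
  measurable_aut_map : measurable_fun setT aut_map;
  measurable_aut_inv : measurable_fun setT aut_inv }.

Section delocation.
Context {R : realType} {Omega : Type}.
Local Notation Y := (Xspace R * I01 R)%type.

(* A Borel automorphism may send a set of positive measure onto a negligible
   one, in which case the delocated graphings have no paths at all. *)
Definition nonsingular (nu : probability (cube R) R) (theta : borel_aut R) :=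
  forall N : set (Xspace R), measurable N ->
    mu_X nu (theta @^-1` N) = 0%E <-> mu_X nu N = 0%E.

Definition lift_dialect (f : Xspace R -> Xspace R) (y : Y) : Y := (f y.1, y.2).

Definition deloc_graphing (theta : borel_aut R) (G : pregraphing R Omega) :
    pregraphing R Omega := {|
  gsupport := theta @` gsupport G;
  edge := edge G;
  source := fun e => lift_dialect theta @` source e;
  realiser := fun e =>
    lift_dialect theta \o realiser G e \o lift_dialect (aut_inv theta);
  weight := weight G |}.

Definition deloc_project (theta : borel_aut R) (a : preproject R Omega) :
    preproject R Omega := {|
  psupport := theta @` psupport a;
  wager := wager a;
  slice := slice a;
  coef := @coef _ _ a;
  graph := fun i => deloc_graphing theta (graph i) |}.

Local Notation projects := (preproject R Omega -> Prop).

Definition deloc (theta : borel_aut R) (A : projects) : projects :=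
  fun b => exists a, A a /\ b = deloc_project theta a.

(* The realisers of a delocated ll-graphing are conjugated by theta.  The
   delocated copies along theta1 and theta2 thus live in the microcosm
   generated by ll and these two automorphisms, which is ll itself when the
   automorphisms belong to ll (deloc_microcosm_ll). *)
Definition deloc_microcosm (rho : square_iso R) (theta1 theta2 : borel_aut R) :
    set (Y -> Y) :=
  monoid_gen (ll rho `|` [set lift_dialect theta1] `|`
    [set lift_dialect (aut_inv theta1)] `|` [set lift_dialect theta2] `|`
    [set lift_dialect (aut_inv theta2)]).

Lemma deloc_microcosm_ll (rho : square_iso R) (theta1 theta2 : borel_aut R) :
  ll rho (lift_dialect theta1) -> ll rho (lift_dialect (aut_inv theta1)) ->
  ll rho (lift_dialect theta2) -> ll rho (lift_dialect (aut_inv theta2)) ->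
  deloc_microcosm rho theta1 theta2 = ll rho.
Proof.
move=> h1 h1' h2 h2'; apply/seteqP; split=> f; last first.
  by move=> ?; apply: monoid_gen_in; left; left; left; left.
elim=> [|{}f [[[[//|->//]|->//]|->//]|->//]|{}f g _ + _ +].
  exact: monoid_gen_id.
exact: monoid_gen_comp.
Qed.

End delocation.

(* Main.v *)
From HB Require Import structures.
From mathcomp Require Import all_boot all_order all_algebra.
From mathcomp Require Import all_classical all_reals all_analysis.
From mathcomp Require Import measurable_realfun.
Require Import Defs.

Set Implicit Arguments.
Unset Strict Implicit.
Unset Printing Implicit Defensive.

Import Order.TTheory GRing.Theory Num.Theory.

Local Open Scope classical_set_scope.
Local Open Scope ring_scope.

(** Write [x = (a, d'.d.s)] for a point of the support of [!A]; then
    [dig x = (a, e'.e.d''.d.s)], where [d' = rho (e', rho (e, d''))], is a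
    measure-preserving bijection onto the support of [!!A] and belongs to the
    microcosm.  Since [!a] only acts on [d] and [s], and [!!a] as well,
    conjugation by [dig] turns [!a] into [!!a].  The project in
    [!A -o !!A] is the graphing with two edges, [dig] and its inverse, up to
    delocation.

    Executing it against a project [b] of [!A] conjugates [b] by [dig], up to
    merging the dialect of [b] with an idle one and forgetting the edges of null
    source; neither affects the measurements, so that for every test [t]
    the interaction of the execution with [t] is that of [b] with
    [t' = dig^-1 t dig].  If [t] is orthogonal to all the [!!a], then [t'] is
    orthogonal to all the [!a], hence to [b], which belongs to their
    biorthogonal. *)

(** * Measure-preserving and null-preserving maps *)

(** Three coordinates of the sequence are ignored by [!!a]: the outer fresh copy, the dialect of
    [!a], which is idle because [!a] is dialect-free, and the inner fresh copy. In [!a] only the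
    fresh copy [d'] is ignored; splitting it twice along [rho] supplies the three.

    The obstacle is that an element [b] of the biorthogonal is an arbitrary project, whose realisers
    may use the dialect and dilate the real line. Its execution is therefore compared with [b] only
    through measurements. The edges of the execution match the edges of [b] of non-null source; the
    others are harmless because a cycle through an edge of null source has null support, for which
    it is enough that realisers preserve null sets, as dilations do. Equal measurements require
    exact preservation of the measure, but only by [dig] and by the map that forgets the idle half
    of a merged dialect. The delocations are merely non-singular: they cancel once [theta2] is
    undone, and non-singularity ensures that the paths of the execution keep positive measure. *)

Lemma preimage_measurable d1 d2 (T1 : measurableType d1)
    (T2 : measurableType d2) (g : T1 -> T2) (S : set T2) :
  measurable_fun setT g -> measurable S -> measurable (g @^-1` S).
Proof. by move=> mg mS; rewrite -[X in measurable X]setTI; exact: mg. Qed.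

Section preserving.
Context {R : realType}.

Definition measure_preserving d1 d2 (T1 : measurableType d1)
    (T2 : measurableType d2) (m1 : set T1 -> \bar R) (m2 : set T2 -> \bar R)
    (g : T1 -> T2) :=
  measurable_fun setT g /\
  forall S, measurable S -> m1 (g @^-1` S) = m2 S.

(** The affine generators of the microcosm rescale Lebesgue measure, so this weaker property is the
    one shared by all realisers. *)
Definition null_preserving d1 d2 (T1 : measurableType d1)
    (T2 : measurableType d2) (m1 : set T1 -> \bar R) (m2 : set T2 -> \bar R)
    (g : T1 -> T2) :=
  measurable_fun setT g /\
  forall S, measurable S -> m2 S = 0%E -> m1 (g @^-1` S) = 0%E.

Lemma measure_preserving_null d1 d2 (T1 : measurableType d1)
    (T2 : measurableType d2) (m1 : set T1 -> \bar R) (m2 : set T2 -> \bar R)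
    (g : T1 -> T2) :
  measure_preserving m1 m2 g -> null_preserving m1 m2 g.
Proof. by move=> [mg gE]; split=> // S mS S0; rewrite gE. Qed.

Lemma measure_preserving_comp d1 d2 d3 (T1 : measurableType d1)
    (T2 : measurableType d2) (T3 : measurableType d3)
    (m1 : set T1 -> \bar R) (m2 : set T2 -> \bar R) (m3 : set T3 -> \bar R)
    (f : T2 -> T3) (g : T1 -> T2) :
  measure_preserving m2 m3 f -> measure_preserving m1 m2 g ->
  measure_preserving m1 m3 (f \o g).
Proof.
move=> [mf fE] [mg gE]; split; first exact: measurableT_comp.
by move=> S mS; rewrite comp_preimage gE ?fE//; exact: preimage_measurable.
Qed.

Lemma null_preserving_comp d1 d2 d3 (T1 : measurableType d1)
    (T2 : measurableType d2) (T3 : measurableType d3)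
    (m1 : set T1 -> \bar R) (m2 : set T2 -> \bar R) (m3 : set T3 -> \bar R)
    (f : T2 -> T3) (g : T1 -> T2) :
  null_preserving m2 m3 f -> null_preserving m1 m2 g ->
  null_preserving m1 m3 (f \o g).
Proof.
move=> [mf fE] [mg gE]; split; first exact: measurableT_comp.
move=> S mS S0; rewrite comp_preimage gE ?fE//; exact: preimage_measurable.
Qed.

Lemma measure_preserving_id d1 (T1 : measurableType d1)
    (m1 : set T1 -> \bar R) : measure_preserving m1 m1 idfun.
Proof. by split=> //; exact: measurable_id. Qed.

Lemma measure_preserving_inv d1 d2 (T1 : measurableType d1)
    (T2 : measurableType d2) (m1 : set T1 -> \bar R) (m2 : set T2 -> \bar R)
    (g : T1 -> T2) (h : T2 -> T1) :
  measure_preserving m1 m2 g -> measurable_fun setT h -> cancel g h ->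
  measure_preserving m2 m1 h.
Proof.
move=> [mg gE] mh gK; split=> // S mS.
rewrite -gE; last exact: preimage_measurable.
by congr (m1 _); apply/seteqP; split=> x; rewrite /preimage/= gK.
Qed.

Section product.
Context d1 d2 d3 (T1 : measurableType d1) (T2 : measurableType d2)
  (T3 : measurableType d3).
Variables (m1 : {sigma_finite_measure set T1 -> \bar R})
  (m2 : {sigma_finite_measure set T2 -> \bar R})
  (m3 : {sigma_finite_measure set T3 -> \bar R}).

(** A product of sigma-finite measures is determined by its values on rectangles; this is applied to
    the pushforward of [m] along [g]. *)
Lemma measure_preserving_rectangles d (T : measurableType d)
    (m : {measure set T -> \bar R}) (g : T -> T1 * T2) :
  measurable_fun setT g ->
  (forall A B, measurable A -> measurable B ->
    m (g @^-1` (A `*` B)) = (m1 A * m2 B)%E) ->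
  measure_preserving m (m1 \x m2)%E g.
Proof.
move=> mg gE; split=> // S mS.
pose g' : {mfun T >-> (T1 * T2)%type} :=
  HB.pack g (isMeasurableFun.Build _ _ _ _ g mg).
by rewrite (@product_measure_unique _ _ _ _ _ m1 m2 (pushforward m g') gE).
Qed.

End product.

(* The library infers this structure for products of subprobabilities only. *)
Section sigma_finite_product.
Context d1 d2 (T1 : measurableType d1) (T2 : measurableType d2).
Variables (m1 : {sigma_finite_measure set T1 -> \bar R})
  (m2 : {sigma_finite_measure set T2 -> \bar R}).

Lemma product_sigma_finite : sigma_finite setT (m1 \x m2)%E.
Proof.
have /sigma_finiteP[F [TF ndF Foo]] := sigma_finiteT m1.
have /sigma_finiteP[G [TG ndG Goo]] := sigma_finiteT m2.
exists (fun n => F n `*` G n).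
  apply/seteqP; split=> [[x y] _|//].
  have [n _ Fnx] : (\bigcup_i F i) x by rewrite -TF.
  have [k _ Gky] : (\bigcup_i G i) y by rewrite -TG.
  exists (maxn n k) => //; split.
    by move: x Fnx; exact/subsetPset/ndF/leq_maxl.
  by move: y Gky; exact/subsetPset/ndG/leq_maxr.
move=> k; have [? ?] := Foo k; have [? ?] := Goo k.
split; first exact: measurableX.
by rewrite product_measure1E// lte_mul_pinfty// ge0_fin_numE.
Qed.

Definition sf_product : {sigma_finite_measure set (T1 * T2)%type -> \bar R} :=
  HB.pack_for {sigma_finite_measure set (T1 * T2)%type -> \bar R} (m1 \x m2)%E
    (Measure_isSigmaFinite.Build _ _ _ (m1 \x m2)%E product_sigma_finite).

End sigma_finite_product.

Section product_maps.
Context d1 d2 d3 (T1 : measurableType d1) (T2 : measurableType d2)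
  (T3 : measurableType d3).
Variables (m1 : {sigma_finite_measure set T1 -> \bar R})
  (m2 : {sigma_finite_measure set T2 -> \bar R})
  (m3 : {sigma_finite_measure set T3 -> \bar R}).

Lemma measure_preserving_prodl (g : T1 -> T2) :
  measure_preserving m1 m2 g ->
  measure_preserving (m1 \x m3)%E (m2 \x m3)%E (fun z => (g z.1, z.2)).
Proof.
move=> [mg gE]; apply: measure_preserving_rectangles.
  by apply: measurable_fun_pair => //; exact: measurableT_comp.
move=> A B mA mB; rewrite (_ : _ @^-1` _ = (g @^-1` A) `*` B)//.
by rewrite [LHS]product_measure1E//= ?gE//; exact: preimage_measurable.
Qed.

Lemma measure_preserving_prodr (g : T1 -> T2) :
  measure_preserving m1 m2 g ->
  measure_preserving (m3 \x m1)%E (m3 \x m2)%E (fun z => (z.1, g z.2)).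
Proof.
move=> [mg gE]; apply: measure_preserving_rectangles.
  by apply: measurable_fun_pair => //; exact: measurableT_comp.
move=> A B mA mB; rewrite (_ : _ @^-1` _ = A `*` (g @^-1` B))//.
by rewrite [LHS]product_measure1E//= ?gE//; exact: preimage_measurable.
Qed.

Lemma measure_preserving_swap :
  measure_preserving (m1 \x m2)%E (m2 \x m1)%E (fun z => (z.2, z.1)).
Proof.
apply: measure_preserving_rectangles; first exact: measurable_fun_pair.
move=> A B mA mB; rewrite (_ : _ @^-1` _ = B `*` A); last first.
  by apply/seteqP; split=> -[x y] [].
by rewrite [LHS]product_measure1E//= muleC.
Qed.

(** The set is a rectangle only after reassociation, so its measure is computed by Tonelli: the
    inner integral over [T2] is the measure of [C] when [x] lies in [A], and zero otherwise. *)
Lemma product_assocE (A : set T1) (C : set (T2 * T3)) :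
  measurable A -> measurable C ->
  ((m1 \x m2) \x m3)%E [set z | A z.1.1 /\ C (z.1.2, z.2)] =
  (m1 A * (m2 \x m3) C)%E.
Proof.
move=> mA mC; set S := [set z | _].
have mS : measurable S.
  apply: measurableI.
    exact: (@preimage_measurable _ _ _ _ (fst \o fst) _
      (measurableT_comp measurable_fst measurable_fst)).
  apply: (@preimage_measurable _ _ _ _
    (fun z : T1 * T2 * T3 => (z.1.2, z.2))) => //.
  apply: measurable_fun_pair => //.
  exact: (measurableT_comp measurable_snd measurable_fst).
rewrite {1}/product_measure1 fubini_tonelli1//=; last first.
  exact: measurable_fun_xsection.
rewrite /fubini_F.
under eq_integral => x _.
  have -> : (\int[m2]_y m3 (xsection S (x, y)))%E =
      ((m2 \x m3) C * (\1_A x)%:E)%E.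
    rewrite indicE; case: (boolP (x \in A)) => xA.
      rewrite mule1; apply: eq_integral => y _ /=; congr (m3 _).
      apply/seteqP; split=> z; rewrite /xsection/= !inE/=; first by case.
      by split=> //; exact: set_mem.
    rewrite mule0 integral0_eq// => y _.
    rewrite (_ : xsection _ _ = set0) ?measure0//.
    apply/seteqP; split=> z; rewrite /xsection/= ?inE//= => -[].
    by move=> /mem_set; rewrite (negbTE xA).
  over.
rewrite ge0_integralZl//= ?integral_indic ?setIT// 1?muleC//.
by apply/measurable_EFinP; exact: measurable_indic.
Qed.

End product_maps.

Lemma measure_preserving_assoc d1 d2 d3 (T1 : measurableType d1)
    (T2 : measurableType d2) (T3 : measurableType d3)
    (m1 : {sigma_finite_measure set T1 -> \bar R})
    (m2 : {sigma_finite_measure set T2 -> \bar R})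
    (m3 : {sigma_finite_measure set T3 -> \bar R}) :
  measure_preserving ((m1 \x m2) \x m3)%E (m1 \x (m2 \x m3))%E
    (fun z => (z.1.1, (z.1.2, z.2))).
Proof.
apply: (@measure_preserving_rectangles _ _ _ _ m1 (sf_product m2 m3) _ _
  ((m1 \x m2) \x m3)%E); last first.
  by move=> A B mA mB; exact: product_assocE.
apply: measurable_fun_pair.
  exact: (measurableT_comp measurable_fst measurable_fst).
apply: measurable_fun_pair => //.
exact: (measurableT_comp measurable_snd measurable_fst).
Qed.

Section null_product.
Context d1 d2 d3 (T1 : measurableType d1) (T2 : measurableType d2)
  (T3 : measurableType d3).
Variables (m1 : {sigma_finite_measure set T1 -> \bar R})
  (m2 : {sigma_finite_measure set T2 -> \bar R})
  (m3 : {sigma_finite_measure set T3 -> \bar R}).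

Lemma measurable_xsection_neq0 (S : set (T1 * T3)) : measurable S ->
  measurable [set x | m3 (xsection S x) != 0%E].
Proof.
move=> mS; rewrite -[X in measurable X]setTI.
by apply: emeasurable_neq => //; exact: measurable_fun_xsection.
Qed.

(** The measure of [S] is the integral of the measures of its sections, and a nonnegative function
    has zero integral exactly when it vanishes almost everywhere. *)
Lemma product_null (S : set (T1 * T3)) : measurable S ->
  (m1 \x m3)%E S = 0%E <-> m1 [set x | m3 (xsection S x) != 0%E] = 0%E.
Proof.
move=> mS; rewrite /product_measure1.
have mf := measurable_fun_xsection m3 mS.
have := ae_eq_integral_abs m1 measurableT mf.
under eq_integral do rewrite gee0_abs//.
move=> ->; split.
  move=> [N [mN N0 NS]]; apply: (subset_measure0 _ mN _ N0).
    exact: measurable_xsection_neq0.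
  by move=> x /= xS; apply: NS => /= /(_ Logic.I); exact/eqP.
move=> h; exists [set x | m3 (xsection S x) != 0%E]; split=> //.
  exact: measurable_xsection_neq0.
by move=> x /= => /not_implyP[_ /eqP].
Qed.
End null_product.

(** The section at [x] of the preimage is the section of [S] at [g x]. The points with a non-null
    section thus form a preimage under [g] of a null set. *)
Lemma null_preserving_prodl d1 d2 d3 (T1 : measurableType d1)
    (T2 : measurableType d2) (T3 : measurableType d3)
    (m1 : {sigma_finite_measure set T1 -> \bar R})
    (m2 : {sigma_finite_measure set T2 -> \bar R})
    (m3 : {sigma_finite_measure set T3 -> \bar R}) (g : T1 -> T2) :
  null_preserving m1 m2 g ->
  null_preserving (m1 \x m3)%E (m2 \x m3)%E (fun z => (g z.1, z.2)).
Proof.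
move=> [mg gE].
have mg' : measurable_fun setT (fun z : T1 * T3 => (g z.1, z.2)).
  by apply: measurable_fun_pair => //; exact: measurableT_comp.
split=> // S mS /(product_null _ _ mS)/gE h.
apply/product_null; first exact: preimage_measurable.
exact/h/measurable_xsection_neq0.
Qed.

End preserving.
Arguments null_preserving_prodl {R d1 d2 d3 T1 T2 T3} m1 m2 m3 {g}.
Arguments measure_preserving_prodl {R d1 d2 d3 T1 T2 T3} m1 m2 m3 {g}.
Arguments measure_preserving_prodr {R d1 d2 d3 T1 T2 T3} m1 m2 m3 {g}.

(** * The Hilbert cube *)

Section cube_measurability.
Context {R : realType}.

Lemma measurable_cube_coord i :
  measurable_fun setT (fun s : cube R => s i : I01 R).
Proof.
move=> _ B mB; rewrite setTI; apply: sub_sigma_algebra.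
by exists i, B.
Qed.

Lemma measurable_fun_cube d (T : measurableType d) (g : T -> cube R) :
  (forall i, measurable_fun setT (fun x => g x i : I01 R)) ->
  measurable_fun setT g.
Proof.
move=> mg; apply: (@measurability _ _ _ (cube R) setT g (@cylinders R)) => //.
move=> _ [_ [i [B [mB ->]]] <-]; exact: mg.
Qed.

(** The head comes second, in the position of the dialect, so that [push] is this map up to
    reassociation. *)
Definition cube_cons (z : cube R * I01 R) : cube R := scons z.2 z.1.

Lemma measurable_cube_cons : measurable_fun setT cube_cons.
Proof.
apply: measurable_fun_cube => -[|i]; first exact: measurable_snd.
exact: (measurableT_comp (measurable_cube_coord i) measurable_fst).
Qed.

Definition cube_uncons (s : cube R) : cube R * I01 R := (sdrop 1 s, s 0%N).

Lemma measurable_cube_uncons : measurable_fun setT cube_uncons.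
Proof.
apply: measurable_fun_pair; last exact: measurable_cube_coord.
by apply: measurable_fun_cube => i; exact: measurable_cube_coord.
Qed.

Lemma cube_consK : cancel cube_cons cube_uncons. Proof. by case. Qed.

Lemma cube_unconsK : cancel cube_uncons cube_cons.
Proof. by move=> s; apply/funext => -[]. Qed.

Definition cube_perm (sigma : nat -> nat) (s : cube R) : cube R := s \o sigma.

Lemma measurable_cube_perm sigma : measurable_fun setT (cube_perm sigma).
Proof. by apply: measurable_fun_cube => i; exact: measurable_cube_coord. Qed.

End cube_measurability.

Section cube_measure.
Context {R : realType} (nu : probability (cube R) R).
Hypothesis nuE : cube_lebesgue nu.

Let box n (B : nat -> set (I01 R)) : set (cube R) :=
  [set s | forall i, (i < n)%N -> B i (s i)].

Let boxes : set (set (cube R)) :=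
  [set C | exists n B, (forall i, measurable (B i)) /\ C = box n B].

Let measurable_box n B : (forall i, measurable (B i)) -> measurable (box n B).
Proof.
move=> mB; rewrite (_ : box n B = \bigcap_(i in [set i | (i < n)%N])
  ((fun s : cube R => s i : I01 R) @^-1` B i)).
  apply: bigcap_measurableType => i _; apply: preimage_measurable => //.
  exact: measurable_cube_coord.
by apply/seteqP; split=> s h i; exact: h.
Qed.

Let nu_box n B : (forall i, measurable (B i)) ->
  nu (box n B) = (\prod_(i < n) leb01 (B i))%E.
Proof. exact: nuE. Qed.

Let boxesI : setI_closed boxes.
Proof.
move=> _ _ [n [B [mB ->]]] [k [C [mC ->]]].
exists (maxn n k), (fun i => (if (i < n)%N then B i else setT) `&`
  (if (i < k)%N then C i else setT)); split.
  by move=> i; apply: measurableI; case: ifP.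
apply/seteqP; split=> s.
  by move=> [sB sC] i _; split; case: ifP => // ?; [exact: sB|exact: sC].
move=> h; split=> i ik.
  by have [] := h i (leq_trans ik (leq_maxl _ _)); rewrite ik.
by have [_] := h i (leq_trans ik (leq_maxr _ _)); rewrite ik.
Qed.

Let measurable_boxes : @measurable _ (cube R) = <<s boxes >>.
Proof.
apply/seteqP; split; last first.
  apply: smallest_sub; first exact: sigma_algebra_measurable.
  by move=> _ [n [B [mB ->]]]; exact: measurable_box.
apply: smallest_sub; first exact: smallest_sigma_algebra.
move=> _ [i [B [mB ->]]]; apply: sub_sigma_algebra.
exists i.+1, (fun j => if j == i then B else setT); split.
  by move=> j; case: eqP.
apply/seteqP; split=> s /=.
  by move=> sB j _; case: eqP => // ->.
by move=> /(_ i (leqnn _)); rewrite eqxx.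
Qed.

(** Boxes are closed under intersection and generate the sigma-algebra, so measures that agree on
    them are equal. The box without constraints is the whole cube and provides the exhausting
    sequence. *)
Lemma measure_preserving_cube d (T : measurableType d)
    (m : {measure set T -> \bar R}) (g : T -> cube R) :
  measurable_fun setT g ->
  (forall n (B : nat -> set (I01 R)), (forall i, measurable (B i)) ->
    m (g @^-1` [set s | forall i, (i < n)%N -> B i (s i)]) =
    (\prod_(i < n) leb01 (B i))%E) ->
  measure_preserving m nu g.
Proof.
move=> mg gE; split=> // S mS.
pose g' : {mfun T >-> cube R} :=
  HB.pack g (isMeasurableFun.Build _ _ _ _ g mg).
have boxT : box 0 (fun=> setT) = setT by apply/seteqP; split.
apply: (@measure_unique _ R _ boxes (fun=> setT) measurable_boxes boxesI
  _ _ (pushforward m g') nu) => //.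
- by move=> _; exists 0%N, (fun=> setT).
- by rewrite bigcup_const//; exists 0%N.
- by move=> _ [n [B [mB ->]]]; rewrite [LHS]gE//; apply/esym; exact: nu_box.
- move=> _; rewrite -boxT [X in (X < _)%E]gE// big_ord0; exact: ltry.
Qed.

Lemma measure_preserving_cube_cons :
  measure_preserving (nu \x leb01)%E nu (@cube_cons R).
Proof.
apply: measure_preserving_cube; first exact: measurable_cube_cons.
case=> [|n] B mB.
  rewrite big_ord0 (_ : _ @^-1` _ = setT); last by apply/seteqP; split.
  exact: probability_setT.
rewrite (_ : _ @^-1` _ = box n (fun i => B i.+1) `*` B 0%N); last first.
  apply/seteqP; split=> -[s x].
    by move=> h; split=> [i ni|]; [exact: (h i.+1)|exact: (h 0%N)].
  by move=> [h h0] [_|i ni]; [exact: h0|exact: h].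
rewrite [LHS]product_measure1E//; last exact: measurable_box.
rewrite big_ord_recl [RHS]muleC; congr (_ * _)%E; exact: nu_box.
Qed.

Lemma measure_preserving_cube_uncons :
  measure_preserving nu (nu \x leb01)%E (@cube_uncons R).
Proof.
apply: measure_preserving_inv measure_preserving_cube_cons _ _.
  exact: measurable_cube_uncons.
exact: cube_consK.
Qed.

(** Padding a box with [setT] up to a bound [K] beyond which [sigma] is the identity does not change
    it. Since [sigma] permutes the indices below [K], the preimage is a box on the same indices,
    whose measure is the same product reordered. *)
Lemma measure_preserving_cube_perm sigma : bijective sigma ->
  (exists n, forall i, (n <= i)%N -> sigma i = i) ->
  measure_preserving nu nu (cube_perm sigma).
Proof.
move=> [tau sigmaK tauK] [N sigmaN].
apply: measure_preserving_cube; first exact: measurable_cube_perm.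
move=> n B mB; pose K := maxn n N.
pose C i := if (i < n)%N then B i else setT.
have mC i : measurable (C i) by rewrite /C; case: ifP.
have sigma_lt i : (sigma i < K)%N = (i < K)%N.
  have [Ki|iK] := leqP K i.
    by rewrite sigmaN ?(leq_trans _ Ki) ?leq_maxr// ltnNge Ki.
  apply: contraTT iK; rewrite -!leqNgt => Ks.
  (* If [sigma i] were at least [K], it would be a fixed point, hence equal to [i] by
     injectivity. *)
  have /(congr1 tau) := sigmaN (sigma i) (leq_trans (leq_maxr n N) Ks).
  by rewrite !sigmaK => <-.
have -> : cube_perm sigma @^-1` [set s | forall i, (i < n)%N -> B i (s i)] =
    box K (fun j => C (tau j)).
  apply/seteqP; split=> s h i iK.
    rewrite /C; case: ifP => // /h; by rewrite /cube_perm/= tauK.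
  have := h (sigma i); rewrite sigma_lt sigmaK (leq_trans iK) ?leq_maxl//.
  by rewrite /C iK => /(_ isT).
have <- : nu (box n B) = (\prod_(i < n) leb01 (B i))%E by rewrite nu_box.
have -> : box n B = box K C.
  apply/seteqP; split=> s h i iK; first by rewrite /C; case: ifP => // /h.
  by have := h i (leq_trans iK (leq_maxl _ _)); rewrite /C iK.
have e (D : nat -> set (I01 R)) :
    (\prod_(i < K) leb01 (D i) = \prod_(i <- iota 0 K) leb01 (D i))%E.
  by rewrite -(big_mkord xpredT (fun i => leb01 (D i))) /index_iota subn0.
rewrite [LHS]nu_box// nu_box// [LHS](e (fun j => C (tau j))) e.
have p : perm_eq (iota 0 K) [seq sigma i | i <- iota 0 K].
  apply: uniq_perm; first exact: iota_uniq.
    by rewrite map_inj_uniq ?iota_uniq//; exact: can_inj sigmaK.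
  move=> i; rewrite mem_iota/= add0n; apply/idP/mapP.
    by exists (tau i) => //; rewrite ?tauK// mem_iota/= add0n -sigma_lt tauK.
  by move=> [j]; rewrite mem_iota/= add0n => jK ->; rewrite sigma_lt.
rewrite [LHS](perm_big _ p)/= [LHS]big_map.
by apply: eq_bigr => i _; rewrite sigmaK.
Qed.

Context (rho : square_iso R).

Definition cube_D (s : cube R) : cube R :=
  scons (rho (s 0%N, s 1%N)) (sdrop 2 s).

Definition cube_Dinv (s : cube R) : cube R :=
  let d := sq_inv rho (s 0%N) in scons d.1 (scons d.2 (sdrop 1 s)).

Lemma cube_DK : cancel cube_D cube_Dinv.
Proof.
by move=> s; apply/funext => -[|[|i]]; rewrite /cube_Dinv/cube_D/= ?sq_mapK.
Qed.

Lemma cube_DinvK : cancel cube_Dinv cube_D.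
Proof.
move=> s; apply/funext => -[|i] //.
by rewrite /cube_Dinv/cube_D/= -surjective_pairing sq_invK.
Qed.

Lemma measurable_cube_Dinv : measurable_fun setT cube_Dinv.
Proof.
have m0 := measurableT_comp (measurable_sq_inv rho) (measurable_cube_coord 0).
apply: measurable_fun_cube => -[|[|i]] /=.
- exact: (measurableT_comp measurable_fst m0).
- exact: (measurableT_comp measurable_snd m0).
- exact: measurable_cube_coord.
Qed.

Lemma measure_preserving_cube_D : measure_preserving nu nu cube_D.
Proof.
(* Removing two heads and reassociating gives the pair [(s 1, s 0)], hence the swap before [rho]. *)
pose sw := @measure_preserving_comp R _ _ _ _ _ _ _ _ _ _ _
  (conj (measurable_sq_map rho) (@sq_map_preserving _ rho))
  (measure_preserving_swap leb01 leb01).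
pose u := measure_preserving_comp (measure_preserving_prodl
  nu (sf_product nu leb01) leb01
  measure_preserving_cube_uncons) measure_preserving_cube_uncons.
pose v := measure_preserving_comp (measure_preserving_assoc nu leb01 leb01) u.
pose w := measure_preserving_comp measure_preserving_cube_cons
  (measure_preserving_comp
    (measure_preserving_prodr (sf_product leb01 leb01) leb01 nu sw) v).
exact: w.
Qed.

Lemma measure_preserving_cube_Dinv : measure_preserving nu nu cube_Dinv.
Proof.
apply: measure_preserving_inv measure_preserving_cube_D _ _.
  exact: measurable_cube_Dinv.
exact: cube_DK.
Qed.

End cube_measure.

(** * Affine maps of the real line *)

Section affine.
Context {R : realType}.

Definition affine (alpha lambda : R) (x : measurableTypeR R) :
  measurableTypeR R := alpha * (x : R) + lambda.

Lemma measurable_affine alpha lambda :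
  measurable_fun setT (affine alpha lambda).
Proof. by apply: measurable_funD => //; exact: measurable_funM. Qed.

(** The right-hand side is a measure in [S] that gives each interval []a, b]] its length, which
    characterises Lebesgue measure. *)
Lemma lebesgue_measure_affine (alpha lambda : R) (S : set (measurableTypeR R)) :
  alpha != 0 -> measurable S ->
  lebesgue_measure S =
  (`|alpha|%:E * lebesgue_measure (affine alpha lambda @^-1` S))%E.
Proof.
move=> a0 mS; pose g := affine alpha lambda.
pose g' : {mfun measurableTypeR R >-> measurableTypeR R} :=
  HB.pack g (isMeasurableFun.Build _ _ _ _ g (measurable_affine alpha lambda)).
apply: (@lebesgue_measure_unique R (mscale (NngNum (normr_ge0 alpha))
  (pushforward lebesgue_measure g'))) => //.
move=> _ [[a b] _ <-]/=; rewrite /mscale/= /pushforward/=.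
have [ap|an|ae] := ltgtP alpha 0; last by rewrite ae eqxx in a0.
(* A negative slope reverses the interval, so the closed end becomes the left one; the length is
   unaffected. *)
- rewrite (_ : _ @^-1` _ =
      `[(b - lambda) / alpha, (a - lambda) / alpha[%classic); last first.
    apply/seteqP; split=> x; rewrite /g/affine/= !in_itv/= => /andP[h1 h2];
      apply/andP; split.
    + by rewrite ler_ndivrMr// mulrC lerBrDr.
    + by rewrite ltr_ndivlMr// mulrC ltrBlDr.
    + by move: h2; rewrite ltr_ndivlMr// mulrC ltrBlDr.
    + by move: h1; rewrite ler_ndivrMr// mulrC lerBrDr.
  rewrite !lebesgue_measure_itv/= !lte_fin ltr_ndivrMr// divfK//.
  rewrite ltrD2r; case: ifP => _; last by rewrite mule0.
  rewrite -!EFinB -EFinM ltr0_norm//; congr EFin.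
  by rewrite -mulrBl opprB addrA subrK mulNr mulrCA divff ?lt_eqF// mulr1 opprB.
- rewrite (_ : _ @^-1` _ =
      `](a - lambda) / alpha, (b - lambda) / alpha]%classic); last first.
    apply/seteqP; split=> x; rewrite /g/affine/= !in_itv/= => /andP[h1 h2];
      apply/andP; split.
    + by rewrite ltr_pdivrMr// mulrC ltrBlDr.
    + by rewrite ler_pdivlMr// mulrC lerBrDr.
    + by move: h1; rewrite ltr_pdivrMr// mulrC ltrBlDr.
    + by move: h2; rewrite ler_pdivlMr// mulrC lerBrDr.
  rewrite !lebesgue_measure_itv/= !lte_fin ltr_pdivrMr// divfK//.
  rewrite ltrD2r; case: ifP => _; last by rewrite mule0.
  rewrite -!EFinB -EFinM gtr0_norm//; congr EFin.
  by rewrite -mulrBl opprB addrA subrK mulrCA divff ?gt_eqF// mulr1.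
Qed.

Lemma null_preserving_affine (alpha lambda : R) : alpha != 0 ->
  null_preserving (@lebesgue_measure R) (@lebesgue_measure R)
    (affine alpha lambda).
Proof.
move=> a0; split; first exact: measurable_affine.
move=> S mS /eqP; rewrite (lebesgue_measure_affine lambda a0 mS) mule_eq0.
by rewrite eqe normr_eq0 (negbTE a0)/= => /eqP.
Qed.

End affine.

(** * Points with dialects, and null sets under the microcosm *)

Section dialect_space.
Context {R : realType} (nu : probability (cube R) R).
Hypothesis nuE : cube_lebesgue nu.
Local Notation Y := (Xspace R * I01 R)%type.
Local Notation Z := (Xspace R * I01 R * I01 R)%type.

Definition sf_X : {sigma_finite_measure set (Xspace R) -> \bar R} :=
  sf_product (@lebesgue_measure R) nu.

Definition sf_Y : {sigma_finite_measure set Y -> \bar R} :=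
  sf_product sf_X (@leb01 R).

Definition sf_Z : {sigma_finite_measure set Z -> \bar R} :=
  sf_product sf_Y (@leb01 R).

Lemma mu_XIIE : mu_XII nu = sf_Z. Proof. by []. Qed.

Lemma measure_preserving_push : measure_preserving sf_Y sf_X (@push R).
Proof.
exact: (measure_preserving_comp (measure_preserving_prodr
  (sf_product nu leb01) nu lebesgue_measure (measure_preserving_cube_cons nuE))
  (measure_preserving_assoc lebesgue_measure nu leb01)).
Qed.

Lemma pushK : cancel (@push R) (@pop R).
Proof. by case=> -[a s] d. Qed.

Lemma measurable_pop : measurable_fun setT (@pop R).
Proof.
have m2 := measurableT_comp (@measurable_cube_uncons R)
  (@measurable_snd _ _ (measurableTypeR R) (cube R)).
apply: measurable_fun_pair; last exact: (measurableT_comp measurable_snd m2).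
apply: measurable_fun_pair => //.
exact: (measurableT_comp measurable_fst m2).
Qed.

Lemma measure_preserving_pop : measure_preserving sf_X sf_Y (@pop R).
Proof.
apply: measure_preserving_inv measure_preserving_push _ _.
  exact: measurable_pop.
exact: pushK.
Qed.

Lemma measure_preserving_cube_dialect (g : cube R -> cube R) :
  measure_preserving nu nu g ->
  measure_preserving sf_Y sf_Y (fun y : Y => ((y.1.1, g y.1.2), y.2)).
Proof.
move=> gE.
exact: (measure_preserving_prodl sf_X sf_X leb01
  (measure_preserving_prodr nu nu lebesgue_measure gE)).
Qed.

Lemma null_preserving_ll_generator (rho : square_iso R) phi :
  ll_generator rho phi -> null_preserving sf_Y sf_Y phi.
Proof.
case=> [alpha lambda a0|sigma bsigma fsigma| | |].
- exact: (null_preserving_prodl sf_X sf_X leb01 (null_preserving_prodl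
    lebesgue_measure lebesgue_measure nu (null_preserving_affine lambda a0))).
- apply: measure_preserving_null.
  exact: (measure_preserving_cube_dialect
    (measure_preserving_cube_perm nuE bsigma fsigma)).
- apply: measure_preserving_null.
  exact: (measure_preserving_cube_dialect (measure_preserving_cube_D nuE rho)).
- apply: measure_preserving_null.
  exact: (measure_preserving_cube_dialect
    (measure_preserving_cube_Dinv nuE rho)).
- apply: measure_preserving_null.
  (* Once the dialect is pushed to the front of the sequence, [xch_map] is the transposition of the
     first two coordinates. *)
  pose swap01 i := if i is j.+2 then j.+2 else (1 - i)%N.
  have swap01K : involutive swap01 by case=> [|[|]].
  have mp : measure_preserving sf_X sf_X (fun x => (x.1, cube_perm swap01 x.2)).
    apply: (measure_preserving_prodr nu nu lebesgue_measure).
    apply: measure_preserving_cube_perm => //.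
      exact: inv_bij.
    by exists 2%N => -[|[|]].
  have := measure_preserving_comp measure_preserving_pop
    (measure_preserving_comp mp measure_preserving_push).
  congr (measure_preserving _ _ _); apply/funext => -[[a s] e].
  congr pair; congr pair; by apply/funext => -[].
Qed.

Lemma null_preserving_ll (rho : square_iso R) phi :
  ll rho phi -> null_preserving sf_Y sf_Y phi.
Proof.
elim=> [|f /null_preserving_ll_generator //|f g _ hf _ hg].
  exact/measure_preserving_null/measure_preserving_id.
exact: null_preserving_comp hf hg.
Qed.

(** A step of the second graphing is the conjugate by this swap of a map acting on the first dialect
    only. This reduces all steps to product maps. *)
Definition swap_dialects (z : Z) : Z := ((z.1.1, z.2), z.1.2).

Lemma measure_preserving_swap_dialects :
  measure_preserving sf_Z sf_Z swap_dialects.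
Proof.
have a := measure_preserving_assoc sf_X leb01 leb01.
have b : measure_preserving (sf_product sf_X (sf_product leb01 leb01)) sf_Z
    (fun z => ((z.1, z.2.1), z.2.2)).
  apply: measure_preserving_inv a _ _; last by case=> -[].
  apply: measurable_fun_pair.
    apply: measurable_fun_pair => //.
    exact: (measurableT_comp measurable_fst measurable_snd).
  exact: (measurableT_comp measurable_snd measurable_snd).
exact: (measure_preserving_comp b (measure_preserving_comp
  (measure_preserving_prodr (sf_product leb01 leb01) (sf_product leb01 leb01)
     sf_X (measure_preserving_swap leb01 leb01)) a)).
Qed.

End dialect_space.

(** * The microcosm *)

Section ll_closure.
Context {R : realType} (rho : square_iso R).
Local Notation Y := (Xspace R * I01 R)%type.

Lemma ll_id : ll rho idfun. Proof. exact: monoid_gen_id. Qed.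

Lemma ll_comp f g : ll rho f -> ll rho g -> ll rho (f \o g).
Proof. exact: monoid_gen_comp. Qed.

Lemma ll_gen f : ll_generator rho f -> ll rho f.
Proof. exact: monoid_gen_in. Qed.

Definition transp (i j k : nat) : nat :=
  if k == i then j else if k == j then i else k.

Lemma transpK i j : involutive (transp i j).
Proof.
rewrite /transp => k; have [->|ki] := eqVneq k i.
  by have [->|ji] := eqVneq j i; rewrite ?eqxx//.
have [->|kj] := eqVneq k j; first by rewrite eqxx.
by rewrite (negbTE ki) (negbTE kj).
Qed.

Lemma transp_finite i j :
  exists n, forall k, (n <= k)%N -> transp i j k = k.
Proof.
exists (maxn i j).+1 => k; rewrite gtn_max => /andP[ik jk].
by rewrite /transp !gtn_eqF.
Qed.

Lemma ll_transp i j : ll rho (perm_map (transp i j)).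
Proof.
apply/ll_gen/ll_perm; first exact/inv_bij/transpK.
exact: transp_finite.
Qed.

Lemma ll_D_map : ll rho (D_map rho). Proof. exact/ll_gen/ll_D. Qed.
Lemma ll_D_inv : ll rho (D_inv rho). Proof. exact/ll_gen/ll_Dinv. Qed.
Lemma ll_xch_map : ll rho (@xch_map R). Proof. exact/ll_gen/ll_xch. Qed.

(** Each generator has an inverse that is again a generator. Inverses turn the images in [reaching]
    into preimages, whose measure is under control. *)
Lemma ll_inv phi : ll rho phi ->
  exists psi, [/\ ll rho psi, cancel phi psi & cancel psi phi].
Proof.
elim=> [|f|f g _ [f' [lf fK f'K]] _ [g' [lg gK g'K]]].
- by exists idfun; split=> //; exact: ll_id.
- case=> [alpha lambda a0|sigma [tau sigmaK tauK] [n sigman]| | |].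
  + exists (affine_map alpha^-1 (- (alpha^-1 * lambda))); split.
    * by apply/ll_gen/ll_affine; rewrite invr_eq0.
    * move=> [[a s] e]; rewrite /affine_map/=; congr (_, _, _).
      by rewrite mulrDr mulrA mulVf// mul1r addrK.
    * move=> [[a s] e]; rewrite /affine_map/=; congr (_, _, _).
      by rewrite mulrDr mulrN !mulrA mulfV// !mul1r subrK.
  + exists (perm_map tau); split.
    * apply/ll_gen/ll_perm; first by exists sigma.
      by exists n => i ni; rewrite -[in LHS](sigman i ni) sigmaK.
    * move=> [[a s] e]; congr (_, _, _); apply/funext => i /=.
      by rewrite tauK.
    * move=> [[a s] e]; congr (_, _, _); apply/funext => i /=.
      by rewrite sigmaK.
  + exists (D_inv rho); split; first exact: ll_D_inv.
    * move=> [[a s] e]; congr (_, _, _); exact: cube_DK.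
    * move=> [[a s] e]; congr (_, _, _); exact: cube_DinvK.
  + exists (D_map rho); split; first exact: ll_D_map.
    * move=> [[a s] e]; congr (_, _, _); exact: cube_DinvK.
    * move=> [[a s] e]; congr (_, _, _); exact: cube_DK.
  + exists (@xch_map R); split; first exact: ll_xch_map.
    * by move=> [[a s] e]; congr (_, _, _); apply/funext => -[].
    * by move=> [[a s] e]; congr (_, _, _); apply/funext => -[].
- exists (g' \o f'); split; first exact: ll_comp.
  + exact: can_comp.
  + exact: can_comp.
Qed.

Definition bang_map (phi : Y -> Y) (y : Y) : Y :=
  (push (push (phi (pop2 y.1)), (pop y.1).2), y.2).

(** Since [bang_map] respects composition, generators suffice. The two added coordinates shift
    permutations by two; [D_map] and its inverse are conjugated by transpositions that move these
    coordinates out of the way; the dialect having become coordinate 1, [xch_map] becomes the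
    transposition of coordinates 1 and 2. *)
Lemma ll_bang phi : ll rho phi -> ll rho (bang_map phi).
Proof.
elim=> [|f|f g _ lf _ lg].
- rewrite (_ : bang_map _ = idfun); first exact: ll_id.
  by apply/funext => -[[a s] e]; congr (_, _, _); apply/funext => -[|[]].
- case=> [alpha lambda a0|sigma [tau sigmaK tauK] [n sigman]| | |].
  + rewrite (_ : bang_map _ = affine_map alpha lambda).
      exact/ll_gen/ll_affine.
    by apply/funext => -[[a s] e]; congr (_, _, _); apply/funext => -[|[]].
  + pose shift2 (h : nat -> nat) i := if i is j.+2 then (h j).+2 else i.
    have shift2K h k : cancel h k -> cancel (shift2 h) (shift2 k).
      by move=> hK [|[|i]] //=; rewrite hK.
    rewrite (_ : bang_map _ = perm_map (shift2 sigma)).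
      apply/ll_gen/ll_perm; first by exists (shift2 tau); exact: shift2K.
      by exists n.+2 => -[|[|i]] //= ni; rewrite sigman.
    by apply/funext => -[[a s] e]; congr (_, _, _); apply/funext => -[|[]].
  + rewrite (_ : bang_map _ = perm_map (transp 1 2) \o perm_map (transp 0 1) \o
        D_map rho \o perm_map (transp 0 2) \o perm_map (transp 1 3)).
      by do !apply: ll_comp; try exact: ll_transp; exact: ll_D_map.
    apply/funext => -[[a s] e]; congr (_, _, _).
    by apply/funext => -[|[|[|[|]]]].
  + rewrite (_ : bang_map _ = perm_map (transp 1 3) \o perm_map (transp 0 2) \o
        D_inv rho \o perm_map (transp 0 1) \o perm_map (transp 1 2)).
      by do !apply: ll_comp; try exact: ll_transp; exact: ll_D_inv.
    apply/funext => -[[a s] e]; congr (_, _, _).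
    by apply/funext => -[|[|[|[|]]]].
  + rewrite (_ : bang_map _ = perm_map (transp 1 2)); first exact: ll_transp.
    by apply/funext => -[[a s] e]; congr (_, _, _); apply/funext => -[|[|[]]].
- rewrite (_ : bang_map _ = bang_map f \o bang_map g); first exact: ll_comp.
  apply/funext => -[[a s] e]; congr (push (push (f _), _), _).
  by rewrite /=; case: (g _) => -[].
Qed.

(** This is how a realiser of the second graphing acts in an execution, where the dialect encodes a
    pair along [rho] and the first half is idle. *)
Definition second_dialect (phi : Y -> Y) (y : Y) : Y :=
  let d := sq_inv rho y.2 in
  let w := phi (y.1, d.2) in (w.1, rho (d.1, w.2)).

Lemma ll_second_dialect phi : ll rho phi -> ll rho (second_dialect phi).
Proof.
have K e : rho ((sq_inv rho e).1, (sq_inv rho e).2) = e.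
  by rewrite -surjective_pairing sq_invK.
elim=> [|f|f g _ lf _ lg].
- rewrite (_ : second_dialect _ = idfun); first exact: ll_id.
  by apply/funext => -[x e]; rewrite /second_dialect/= K.
- case=> [alpha lambda a0|sigma bsigma fsigma| | |].
  + rewrite (_ : second_dialect _ = affine_map alpha lambda).
      exact/ll_gen/ll_affine.
    by apply/funext => -[[a s] e]; rewrite /second_dialect/= K.
  + rewrite (_ : second_dialect _ = perm_map sigma).
      exact/ll_gen/ll_perm.
    by apply/funext => -[[a s] e]; rewrite /second_dialect/= K.
  + rewrite (_ : second_dialect _ = D_map rho); first exact: ll_D_map.
    by apply/funext => -[[a s] e]; rewrite /second_dialect/= K.
  + rewrite (_ : second_dialect _ = D_inv rho); first exact: ll_D_inv.
    by apply/funext => -[[a s] e]; rewrite /second_dialect/= K.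
  (* The microcosm cannot split a dialect in place. The outer exchanges bring it into the sequence
     and back; in between, [D_inv] splits it, the inner exchange trades its second half for the
     coordinate parked in the dialect, and [D_map] merges again. *)
  + rewrite (_ : second_dialect _ = @xch_map R \o D_map rho \o
        perm_map (transp 0 1) \o @xch_map R \o perm_map (transp 0 1) \o
        D_inv rho \o @xch_map R).
      by do !apply: ll_comp; try exact: ll_transp; try exact: ll_xch_map;
        [exact: ll_D_map|exact: ll_D_inv].
    by apply/funext => -[[a s] e]; congr (_, _, _); apply/funext => -[|[|]].
- rewrite (_ : second_dialect _ = second_dialect f \o second_dialect g).
    exact: ll_comp.
  apply/funext => -[[a s] e]; rewrite /second_dialect/= sq_mapK/=.
  by rewrite -surjective_pairing.
Qed.

Definition cube_dig (s : cube R) : cube R :=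
  let d := sq_inv rho (s 0%N) in let e := sq_inv rho d.2 in
  scons d.1 (scons e.1 (scons e.2 (sdrop 1 s))).

Definition cube_undig (s : cube R) : cube R :=
  scons (rho (s 0%N, rho (s 1%N, s 2%N))) (sdrop 3 s).

Lemma cube_digK : cancel cube_dig cube_undig.
Proof.
move=> s; apply/funext => -[|i] //.
by rewrite /cube_undig/cube_dig/= !(sq_invK, =^~ surjective_pairing).
Qed.

Lemma cube_undigK : cancel cube_undig cube_dig.
Proof.
move=> s; apply/funext => -[|[|[|i]]];
  by rewrite /cube_undig/cube_dig/= ?sq_mapK.
Qed.

(** [cube_Dinv] splits only the head, so the second half is moved to the front before being split in
    turn; the last two transpositions restore the order [e'], [e], [d'']. *)
Lemma cube_digE : cube_dig = cube_perm (transp 1 2) \o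
  cube_perm (transp 0 2) \o cube_Dinv rho \o cube_perm (transp 0 1) \o
  cube_Dinv rho.
Proof. by apply/funext => s; apply/funext => -[|[|[|i]]]. Qed.

Lemma cube_undigE : cube_undig = cube_D rho \o cube_perm (transp 0 1) \o
  cube_D rho \o cube_perm (transp 0 2) \o cube_perm (transp 1 2).
Proof. by apply/funext => s; apply/funext => -[|[|[|i]]]. Qed.

Definition dig (x : Xspace R) : Xspace R := (x.1, cube_dig x.2).
Definition undig (x : Xspace R) : Xspace R := (x.1, cube_undig x.2).

Lemma digK : cancel dig undig.
Proof. by move=> [a s]; rewrite /dig/undig/= cube_digK. Qed.

Lemma undigK : cancel undig dig.
Proof. by move=> [a s]; rewrite /dig/undig/= cube_undigK. Qed.

Lemma ll_dig : ll rho (lift_dialect dig).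
Proof.
rewrite (_ : lift_dialect _ = perm_map (transp 1 2) \o perm_map (transp 0 2) \o
  D_inv rho \o perm_map (transp 0 1) \o D_inv rho).
  by do !apply: ll_comp; try exact: ll_transp; exact: ll_D_inv.
by apply/funext => -[[a s] e]; rewrite /lift_dialect/dig/= cube_digE.
Qed.

Lemma ll_undig : ll rho (lift_dialect undig).
Proof.
rewrite (_ : lift_dialect _ = D_map rho \o perm_map (transp 0 1) \o
  D_map rho \o perm_map (transp 0 2) \o perm_map (transp 1 2)).
  by do !apply: ll_comp; try exact: ll_transp; exact: ll_D_map.
by apply/funext => -[[a s] e]; rewrite /lift_dialect/undig/= cube_undigE.
Qed.

(* Both sides keep the three coordinates added by [dig] untouched. *)
Lemma bang_bang_dig (phi : Y -> Y) (x : Xspace R) (e : I01 R) :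
  bang_map (bang_map phi) (dig x, e) =
  lift_dialect dig (bang_map phi (x, e)).
Proof.
by congr (_, _, _); apply/funext => -[|[|[|[|]]]].
Qed.

Context (nu : probability (cube R) R) (nuE : cube_lebesgue nu).

Lemma measure_preserving_dig : measure_preserving (sf_X nu) (sf_X nu) dig.
Proof.
apply: (measure_preserving_prodr nu nu lebesgue_measure).
rewrite cube_digE.
by do !apply: measure_preserving_comp;
  try exact: (measure_preserving_cube_Dinv nuE);
  exact: (measure_preserving_cube_perm nuE (inv_bij (transpK _ _))
  (transp_finite _ _)).
Qed.

Lemma measure_preserving_undig : measure_preserving (sf_X nu) (sf_X nu) undig.
Proof.
apply: (measure_preserving_prodr nu nu lebesgue_measure).
rewrite cube_undigE.
by do !apply: measure_preserving_comp;
  try exact: (measure_preserving_cube_D nuE);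
  exact: (measure_preserving_cube_perm nuE (inv_bij (transpK _ _))
  (transp_finite _ _)).
Qed.

End ll_closure.

(** * Measurement *)

Section equality_sets.
Context {R : realType} d (T : measurableType d).

Lemma measurable_eq_I01 (f g : T -> I01 R) :
  measurable_fun setT f -> measurable_fun setT g ->
  measurable [set x | f x = g x].
Proof.
move=> mf mg.
have mv : measurable_fun setT (@unit_val R : I01 R -> measurableTypeR R).
  by move=> _ B mB; exists B.
have := measurable_fun_eqr (measurableT_comp mv mf) (measurableT_comp mv mg).
move=> /(_ measurableT [set true] Logic.I); rewrite setTI.
congr measurable; apply/seteqP; split=> x /=.
  by move=> /eqP/unit_val_inj.
by move=> ->; rewrite eqxx.
Qed.

Lemma measurable_eq_pair d1 d2 (T1 : measurableType d1) (T2 : measurableType d2)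
    (f g : T -> T1 * T2) :
  measurable [set x | (f x).1 = (g x).1] ->
  measurable [set x | (f x).2 = (g x).2] -> measurable [set x | f x = g x].
Proof.
move=> m1 m2; have := measurableI _ _ m1 m2; congr measurable.
apply/seteqP; split=> x /=; last by move=> ->.
by case: (f x) (g x) => a b [c e] /= [-> ->].
Qed.

Lemma measurable_eq_cube (f g : T -> cube R) :
  measurable_fun setT f -> measurable_fun setT g ->
  measurable [set x | f x = g x].
Proof.
move=> mf mg; rewrite (_ : [set x | _] = \bigcap_i [set x | f x i = g x i]).
  apply: bigcap_measurableType => i _; apply: measurable_eq_I01.
    exact: (measurableT_comp (measurable_cube_coord i) mf).
  exact: (measurableT_comp (measurable_cube_coord i) mg).
apply/seteqP; split=> x /= h; first by move=> i _ /=; rewrite h.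
by apply/funext => i; exact: (h i Logic.I).
Qed.

Lemma measurable_eq_real (f g : T -> measurableTypeR R) :
  measurable_fun setT f -> measurable_fun setT g ->
  measurable [set x | f x = g x].
Proof.
move=> mf mg; have := measurable_fun_eqr mf mg.
move=> /(_ measurableT [set true] Logic.I); rewrite setTI.
by congr measurable; apply/seteqP; split=> x /= /eqP.
Qed.

(** Equality is tested coordinate by coordinate, with a countable intersection for the cube. It
    makes the set of points to which a path returns measurable. *)
Lemma measurable_eq_dialects (f g : T -> Xspace R * I01 R * I01 R) :
  measurable_fun setT f -> measurable_fun setT g ->
  measurable [set x | f x = g x].
Proof.
move=> mf mg.
have mf1 := measurableT_comp measurable_fst mf.
have mg1 := measurableT_comp measurable_fst mg.
have mf11 := measurableT_comp measurable_fst mf1.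
have mg11 := measurableT_comp measurable_fst mg1.
apply: measurable_eq_pair; [apply: measurable_eq_pair|];
  [apply: measurable_eq_pair| |].
- apply: measurable_eq_real.
    exact: (measurableT_comp measurable_fst mf11).
  exact: (measurableT_comp measurable_fst mg11).
- apply: measurable_eq_cube.
    exact: (measurableT_comp measurable_snd mf11).
  exact: (measurableT_comp measurable_snd mg11).
- apply: measurable_eq_I01.
    exact: (measurableT_comp measurable_snd mf1).
  exact: (measurableT_comp measurable_snd mg1).
- apply: measurable_eq_I01.
    exact: (measurableT_comp measurable_snd mf).
  exact: (measurableT_comp measurable_snd mg).
Qed.

End equality_sets.

Lemma integral_mu_XII_cst (R : realType) (nu : probability (cube R) R)
    (D : set (Xspace R * I01 R * I01 R)) (c : \bar R) : measurable D ->
  (\int[mu_XII nu]_(z in D) c = c * sf_Z nu D)%E.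
Proof. by move=> mD; exact: (@integral_cst _ _ R (sf_Z nu) D mD c). Qed.

(** * Cycle supports and edges of null source *)

Section regular.
Context {R : realType} {Omega : Type} (nu : probability (cube R) R).
Local Notation Z := (Xspace R * I01 R * I01 R)%type.
Local Notation mu := (sf_Z nu).

Definition regular (F G : pregraphing R Omega) :=
  forall e : edge F + edge G,
    measurable (step_source e) /\ null_preserving mu mu (step e).

Lemma regular_graphings (nuE : cube_lebesgue nu) (rho : square_iso R) F G :
  is_graphing (ll rho) F -> is_graphing (ll rho) G -> regular F G.
Proof.
move=> [_ hF] [_ hG] [e|e].
- have [ms _ /(null_preserving_ll nuE) le _] := hF e; split.
    exact: (@preimage_measurable _ _ Z (Xspace R * I01 R)%type fst).
  exact: (null_preserving_prodl (sf_Y nu) (sf_Y nu) leb01 le).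
- have sw := measure_preserving_swap_dialects nu.
  have [ms _ /(null_preserving_ll nuE) le _] := hG e; split.
    exact: (@preimage_measurable _ _ Z (Xspace R * I01 R)%type
      (fst \o @swap_dialects R) _ (measurableT_comp measurable_fst sw.1)).
  have sw' := measure_preserving_null sw.
  exact: (null_preserving_comp sw' (null_preserving_comp
    (null_preserving_prodl (sf_Y nu) (sf_Y nu) leb01 le) sw')).
Qed.

Context (F G : pregraphing R Omega) (FG : regular F G).
Implicit Type p : seq (edge F + edge G).

Lemma measurable_path_source p : measurable (path_source p).
Proof.
elim: p => [|e p IH] /=; first exact: measurableT.
have [ms [me _]] := FG e; apply: measurableI => //.
exact: preimage_measurable.
Qed.

Lemma measurable_path_map p : measurable_fun setT (path_map p).
Proof.
elim: p => [|e p IH]; first exact: measurable_id.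
exact: (measurableT_comp IH (FG e).2.1).
Qed.

Lemma measurable_cycle_support p : measurable (cycle_support p).
Proof.
apply: measurableI; first exact: measurable_path_source.
apply: measurable_eq_dialects; first exact: measurable_path_map.
exact: measurable_id.
Qed.

(** The source of the path lies in the preimage of the source of [e] under the earlier steps, and
    these pull null sets back to null sets. *)
Lemma path_source_null p e : e \in p -> mu (step_source e) = 0%E ->
  mu (path_source p) = 0%E.
Proof.
elim: p => [|e' p IH]; first by rewrite in_nil.
rewrite inE => /predU1P[<-|ep] h.
  apply: (subset_measure0 _ _ _ h).
  - exact: (measurable_path_source (e :: p)).
  - by have [] := FG e.
  - by move=> z [].
have mp : measurable (step e' @^-1` path_source p).
  by apply: preimage_measurable (measurable_path_source p); exact: (FG e').2.1.
apply: (subset_measure0 (measurable_path_source (e' :: p)) mp).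
  by move=> z [].
by apply: (FG e').2.2; [exact: measurable_path_source|exact: IH].
Qed.

Lemma cycle_support_null p e : e \in p -> mu (step_source e) = 0%E ->
  mu (cycle_support p) = 0%E.
Proof.
move=> ep e0.
apply: (subset_measure0 (measurable_cycle_support p)
  (measurable_path_source p)).
  by move=> z [].
exact: path_source_null ep e0.
Qed.

End regular.

(* [kappa] records what [pi] forgets and is left fixed by all steps, so that a
   path closes up at [z] as soon as its image closes up at [pi z]. *)
Section transfer.
Context {R : realType} {Omega : Type} (one : Omega) (mul : Monoid.law one)
  (nu : probability (cube R) R) (m : Omega -> \bar R).
Hypothesis m_ge0 : forall w, (0 <= m w)%E.
Local Notation Z := (Xspace R * I01 R * I01 R)%type.
Local Notation mu := (sf_Z nu).

Context (F1 G1 F2 G2 : pregraphing R Omega).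
Context (h : edge F1 + edge G1 -> edge F2 + edge G2).
Context (pi : Z -> Z) (K : Type) (kappa : Z -> K).
Hypothesis reg : regular nu F2 G2.
Hypothesis h_inj : injective h.
Hypothesis h_alternate : forall e e', alternate (h e) (h e') = alternate e e'.
Hypothesis h_weight : forall e, step_weight (h e) = step_weight e.
Hypothesis h_source : forall e z,
  step_source e z <-> step_source (h e) (pi z).
Hypothesis h_step : forall e z, pi (step e z) = step (h e) (pi z).
Hypothesis kappa_step : forall (e : edge F1 + edge G1) z,
  kappa (step e z) = kappa z.
Hypothesis pi_kappa_inj : forall z z',
  pi z = pi z' -> kappa z = kappa z' -> z = z'.
Hypothesis pi_mp : measure_preserving mu mu pi.
Hypothesis h_range : forall e, ~ range h e -> mu (step_source e) = 0%E.

Let path_source_transfer p z : path_source p z <-> path_source (map h p) (pi z).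
Proof.
elim: p z => //= e p IH z; split=> -[] /h_source ez; rewrite /preimage/=.
  by move=> /IH pz; split=> //; rewrite /preimage/= -h_step.
by move=> pz; split=> //; apply/IH; rewrite h_step.
Qed.

Let path_map_transfer p z : pi (path_map p z) = path_map (map h p) (pi z).
Proof.
by elim: p z => //= e p IH z; rewrite /path_map/= in IH *; rewrite IH h_step.
Qed.

Let kappa_path_map (p : seq (edge F1 + edge G1)) z :
  kappa (path_map p z) = kappa z.
Proof.
elim: p z => //= e p IH z; rewrite /path_map/= in IH *.
by rewrite IH kappa_step.
Qed.

Let cycle_support_transfer p :
  cycle_support p = pi @^-1` cycle_support (map h p).
Proof.
apply/seteqP; split=> z; rewrite /cycle_support/preimage/=.
  by move=> [/path_source_transfer pz pzE]; rewrite -path_map_transfer pzE.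
move=> [/path_source_transfer pz]; rewrite -path_map_transfer => e.
by split=> //; apply: pi_kappa_inj => //; exact: kappa_path_map.
Qed.

Let alternating_cycle_transfer p :
  alternating_cycle (map h p) <-> alternating_cycle p.
Proof.
rewrite /alternating_cycle -!size_eq0 size_map; apply: and_iff_compat_l.
suff -> : cycle (@alternate R Omega F2 G2) (map h p) =
    cycle (@alternate R Omega F1 G1) p by [].
by rewrite cycle_map; apply: eq_cycle => x y; exact: h_alternate.
Qed.

Let rotations_transfer p : size (rotations (map h p)) = size (rotations p).
Proof.
rewrite /rotations size_map.
rewrite (_ : [seq rot i (map h p) | i <- iota 0 (size p)] =
  [seq map h q | q <- [seq rot i p | i <- iota 0 (size p)]]).
  by rewrite undup_map_inj ?size_map//; exact: inj_map.
by rewrite -map_comp; apply: eq_map => i /=; rewrite map_rot.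
Qed.

Let cycle_value (F G : pregraphing R Omega) (p : seq (edge F + edge G)) :=
  (((size (rotations p))%:R^-1)%:E *
    \int[mu_XII nu]_(z in cycle_support p) m (path_weight mul p))%E.

Let cycle_value_ge0 F G p : (0 <= @cycle_value F G p)%E.
Proof.
by apply: mule_ge0; [rewrite lee_fin invr_ge0|apply: integral_ge0].
Qed.

(** The integrand is constant on the support of a cycle, so only its weight, its number of rotations
    and the measure of its support matter; [pi] preserves the last. *)
Let cycle_value_transfer p : cycle_value (map h p) = cycle_value p.
Proof.
rewrite /cycle_value rotations_transfer; congr (_ * _)%E.
have -> : path_weight mul (map h p) = path_weight mul p.
  by rewrite /path_weight big_map; apply: eq_bigr => e _; exact: h_weight.
have mc := measurable_cycle_support reg (map h p).
have mc' : measurable (cycle_support p).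
  by rewrite cycle_support_transfer; exact: (preimage_measurable pi_mp.1 mc).
rewrite (integral_mu_XII_cst nu _ mc) (integral_mu_XII_cst nu _ mc').
by rewrite cycle_support_transfer pi_mp.2.
Qed.

Let measurementE F G : measurement mul nu m F G =
  (\esum_(p in [set p : seq (edge F + edge G) | alternating_cycle p])
    cycle_value p)%E.
Proof. by []. Qed.

Let cycle_value_null F G p e : regular nu F G -> e \in p ->
  mu (step_source e) = 0%E -> @cycle_value F G p = 0%E.
Proof.
move=> FG ep e0; rewrite /cycle_value integral_mu_XII_cst; last first.
  exact: (measurable_cycle_support FG).
by rewrite (cycle_support_null FG ep e0) !mule0.
Qed.

Let range_map (p : seq (edge F2 + edge G2)) :
  ~ range (map h) p -> exists2 e, e \in p & ~ range h e.
Proof.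
move=> hp; apply: contrapT => H; apply: hp.
have {}H e : e \in p -> range h e.
  by move=> ep; apply: contrapT => eh; apply: H; exists e.
elim: p H => [|e p IH] H; first by exists [::].
have [p' _ <-] : range (map h) p.
  by apply: IH => e' e'p; apply: H; rewrite inE e'p orbT.
have [e' _ <-] := H e (mem_head _ _).
by exists (e' :: p').
Qed.

(** A cycle of the second pair that is not in the image of [map h] uses an edge of null source,
    hence contributes zero. The remaining cycles are reindexed along [map h]. *)
Lemma measurement_transfer :
  measurement mul nu m F1 G1 = measurement mul nu m F2 G2.
Proof.
rewrite !measurementE.
rewrite [RHS](esumID (range (map h))); last first.
  by move=> p _; exact: cycle_value_ge0.
rewrite [X in (_ + X)%E]esum1 ?adde0; last first.
  move=> p [_ /range_map[e ep eh]].
  exact: (cycle_value_null reg ep (h_range eh)).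
rewrite [RHS](@reindex_esum _ _ _ [set p | alternating_cycle p] _ (map h)).
  by apply: eq_esum => p _; exact/esym/cycle_value_transfer.
split=> [p /alternating_cycle_transfer ap|p q _ _|p [ap [q _ qp]]].
- by split=> //; exists p.
- exact: inj_map.
- by exists q => //; apply/alternating_cycle_transfer; rewrite qp.
Qed.

End transfer.

Lemma eq_pregraphing (R : realType) (Omega : Type) (S S' : set (Xspace R))
    (E : choiceType) (src src' : E -> set (Xspace R * I01 R))
    (phi phi' : E -> Xspace R * I01 R -> Xspace R * I01 R) (w : E -> Omega) :
  S = S' -> src = src' -> phi = phi' ->
  Pregraphing S src phi w = Pregraphing S' src' phi' w.
Proof. by move=> -> -> ->. Qed.

Lemma eq_preproject (R : realType) (Omega : Type) (S S' : set (Xspace R))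
    (w : \bar R) (I : finType) (c : I -> R) (g g' : I -> pregraphing R Omega) :
  S = S' -> g = g' -> Preproject S w c g = Preproject S' w c g'.
Proof. by move=> -> ->. Qed.

(** * Symmetry of the interaction *)

Section symmetry.
Context {R : realType} {Omega : Type} (one : Omega) (mul : Monoid.law one)
  (nu : probability (cube R) R) (m : Omega -> \bar R) (rho : square_iso R).
Hypothesis nuE : cube_lebesgue nu.
Hypothesis m_ge0 : forall w, (0 <= m w)%E.

(** Transfer along the exchange of the two graphings and of their dialects; nothing is forgotten, so
    [kappa] is constant. Symmetry is what includes a set of projects in its biorthogonal. *)
Lemma measurement_sym (F G : pregraphing R Omega) : regular nu G F ->
  measurement mul nu m F G = measurement mul nu m G F.
Proof.
move=> GF.
pose h (e : edge F + edge G) : edge G + edge F :=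
  match e with inl e => inr e | inr e => inl e end.
have hK : injective h by move=> [e|e] [e'|e'] //= [->].
apply: (@measurement_transfer _ _ _ mul nu m m_ge0 F G G F h (@swap_dialects R)
  unit (fun=> tt) GF hK).
- by move=> [e|e] [e'|e'].
- by case.
- by case=> e [[x d] d'].
- case=> e [[x d] d'] //.
  by rewrite /swap_dialects/= -surjective_pairing.
- by [].
- by move=> [[x d] d'] [[y c] c'] [-> -> ->].
- exact: measure_preserving_swap_dialects.
- by move=> [e|e] []; [exists (inr e)|exists (inl e)].
Qed.

Lemma interaction_sym (a b : preproject R Omega) :
  is_project (ll rho) a -> is_project (ll rho) b ->
  interaction mul nu m a b = interaction mul nu m b a.
Proof.
move=> [_ _ ha] [_ _ hb]; rewrite /interaction; congr absorb.
congr (_ + _)%E; first by rewrite addeC.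
rewrite exchange_big/=; apply: eq_bigr => j _; apply: eq_bigr => i _.
rewrite mulrC measurement_sym//.
exact: (regular_graphings nuE (hb j).1 (ha i).1).
Qed.

Lemma orthogonal_sym (a b : preproject R Omega) :
  is_project (ll rho) a -> is_project (ll rho) b ->
  orthogonal_projects mul nu m a b -> orthogonal_projects mul nu m b a.
Proof. by move=> ha hb [? ? ?]; split; rewrite // interaction_sym. Qed.

End symmetry.

(** * Delocation and exponential *)

Section delocation.
Context {R : realType}.
Local Notation Y := (Xspace R * I01 R)%type.
Local Notation Z := (Xspace R * I01 R * I01 R)%type.

Definition aut_sym (theta : borel_aut R) : borel_aut R :=
  BorelAut (aut_invK theta) (aut_mapK theta) (measurable_aut_inv theta)
    (measurable_aut_map theta).

Lemma image_autE (theta : borel_aut R) (S : set (Xspace R)) :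
  theta @` S = aut_inv theta @^-1` S.
Proof.
apply/seteqP; split=> x.
  by move=> [y Sy <-]; rewrite /preimage/= aut_mapK.
by move=> Sx; exists (aut_inv theta x) => //; rewrite aut_invK.
Qed.

Lemma image_lift_autE (theta : borel_aut R) (S : set Y) :
  lift_dialect theta @` S = lift_dialect (aut_inv theta) @^-1` S.
Proof.
apply/seteqP; split=> [x [y Sy <-]|x Sx].
  by rewrite /preimage/lift_dialect/= aut_mapK; case: y Sy.
exists (lift_dialect (aut_inv theta) x) => //.
by rewrite /lift_dialect/= aut_invK; case: x Sx.
Qed.

Lemma image_lift_autP (theta : borel_aut R) (S : set Y) y :
  (lift_dialect theta @` S) y <-> S (lift_dialect (aut_inv theta) y).
Proof. by rewrite image_lift_autE. Qed.

Lemma measurable_lift_dialect (f : Xspace R -> Xspace R) :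
  measurable_fun setT f -> measurable_fun setT (lift_dialect f).
Proof.
move=> mf; apply: measurable_fun_pair => //.
exact: (measurableT_comp mf measurable_fst).
Qed.

Context {Omega : Type}.

Lemma deloc_graphing_aut_symK (theta : borel_aut R) (G : pregraphing R Omega) :
  deloc_graphing theta (deloc_graphing (aut_sym theta) G) = G.
Proof.
case: G => S E src phi w; rewrite /deloc_graphing/=; apply: eq_pregraphing.
- rewrite (image_autE (aut_sym theta)) image_autE.
  by apply/funext => x; rewrite /preimage/= aut_invK.
- apply/funext => e; rewrite (image_lift_autE (aut_sym theta)).
  rewrite image_lift_autE; apply/funext => -[x d].
  by rewrite /preimage/lift_dialect/= aut_invK.
- apply/funext => e; apply/funext => -[x d]; rewrite /lift_dialect/= aut_invK.
  by rewrite aut_invK; case: (phi _ _).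
Qed.

(** Every project is thus a delocated copy along [theta], so that membership in [deloc theta] can be
    checked on the conjugate by the inverse. *)
Lemma deloc_project_aut_symK (theta : borel_aut R) (a : preproject R Omega) :
  deloc_project theta (deloc_project (aut_sym theta) a) = a.
Proof.
case: a => S w I c g; rewrite /deloc_project/=; apply: eq_preproject.
- rewrite (image_autE (aut_sym theta)) image_autE.
  by apply/funext => x; rewrite /preimage/= aut_invK.
- by apply/funext => i; exact: deloc_graphing_aut_symK.
Qed.

Context (one : Omega) (mul : Monoid.law one)
  (nu : probability (cube R) R) (m : Omega -> \bar R) (rho : square_iso R).
Hypothesis nuE : cube_lebesgue nu.
Hypothesis m_ge0 : forall w, (0 <= m w)%E.

Lemma nonsingular_null_preserving (theta : borel_aut R) :
  nonsingular nu theta ->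
  null_preserving (sf_X nu) (sf_X nu) theta /\
  null_preserving (sf_X nu) (sf_X nu) (aut_inv theta).
Proof.
move=> ns; split; split;
  [exact: measurable_aut_map| |exact: measurable_aut_inv|].
- by move=> N mN N0; apply/(ns N mN).
- move=> N mN N0; apply/ns.
    by apply: preimage_measurable mN; exact: measurable_aut_inv.
  rewrite (_ : _ @^-1` _ = N)//.
  by apply/funext => x; rewrite /preimage/= aut_mapK.
Qed.

(** Conjugating both graphings by one automorphism matches their paths, and supports become
    preimages under its inverse. The automorphism intended is [undig_aut], which preserves the
    measure, and not a delocation, which is only non-singular. *)
Lemma measurement_deloc (theta : borel_aut R) (F G : pregraphing R Omega) :
  measure_preserving (sf_X nu) (sf_X nu) (aut_inv theta) -> regular nu F G ->
  measurement mul nu m (deloc_graphing theta F) (deloc_graphing theta G) =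
  measurement mul nu m F G.
Proof.
move=> mp FG.
apply: (@measurement_transfer _ _ _ mul nu m m_ge0 (deloc_graphing theta F)
  (deloc_graphing theta G) F G idfun
  (fun z : Z => ((aut_inv theta z.1.1, z.1.2), z.2)) unit (fun=> tt) FG) => //.
- by case=> e [[x d] d']; exact: (image_lift_autP theta).
- case=> e [[x d] d'] /=; rewrite /lift_dialect/= aut_mapK //.
  by rewrite -surjective_pairing.
- move=> [[x d] d'] [[x' c] c'] [e -> ->] _; congr (_, _, _).
  by rewrite -[x](aut_invK theta) e aut_invK.
- exact: (measure_preserving_prodl (sf_Y nu) (sf_Y nu) leb01
    (measure_preserving_prodl (sf_X nu) (sf_X nu) leb01 mp)).
Qed.

Lemma interaction_deloc (theta : borel_aut R) (a b : preproject R Omega) :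
  measure_preserving (sf_X nu) (sf_X nu) (aut_inv theta) ->
  is_project (ll rho) a -> is_project (ll rho) b ->
  interaction mul nu m (deloc_project theta a) (deloc_project theta b) =
  interaction mul nu m a b.
Proof.
move=> mp [_ _ ha] [_ _ hb]; rewrite /interaction; congr absorb.
congr (_ + _)%E; apply: eq_bigr => i _; apply: eq_bigr => j _.
rewrite measurement_deloc//.
exact: (regular_graphings nuE (ha i).1 (hb j).1).
Qed.

Lemma measurable_image_aut (theta : borel_aut R) (S : set (Xspace R)) :
  measurable S -> measurable (theta @` S).
Proof.
by rewrite image_autE; apply: preimage_measurable; exact: measurable_aut_inv.
Qed.

Lemma is_graphing_deloc (theta : borel_aut R) (G : pregraphing R Omega) :
  ll rho (lift_dialect theta) -> ll rho (lift_dialect (aut_inv theta)) ->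
  is_graphing (ll rho) G -> is_graphing (ll rho) (deloc_graphing theta G).
Proof.
move=> lt lt' [mG hG]; split; first exact: measurable_image_aut.
move=> e; have [ms sS le eS] := hG e; split.
- rewrite /= image_lift_autE; apply: preimage_measurable ms.
  by apply: measurable_lift_dialect; exact: measurable_aut_inv.
- by move=> _ [y /sS[Sy _] <-]; split=> //; exists y.1.
- by apply: ll_comp => //; exact: ll_comp.
- move=> _ [_ [y sy <-] <-].
  have [Sw _] : (gsupport G `*` setT) (realiser G e y) by apply: eS; exists y.
  split=> //=; exists (realiser G e y).1 => //.
  by rewrite /lift_dialect/= aut_mapK -surjective_pairing.
Qed.

Lemma is_project_deloc (theta : borel_aut R) (a : preproject R Omega) :
  ll rho (lift_dialect theta) -> ll rho (lift_dialect (aut_inv theta)) ->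
  is_project (ll rho) a -> is_project (ll rho) (deloc_project theta a).
Proof.
move=> lt lt' [mS w0 ha]; split=> //; first exact: measurable_image_aut.
move=> i; have [hG eqS] := ha i; split; last by rewrite /= eqS.
exact: is_graphing_deloc.
Qed.

End delocation.

(** * Conjugation of [!!a] into [!a] *)

Section digging.
Context {R : realType} (rho : square_iso R) (nu : probability (cube R) R).
Hypothesis nuE : cube_lebesgue nu.

Definition undig_aut : borel_aut R :=
  BorelAut (undigK rho) (digK rho) (measure_preserving_undig rho nuE).1
    (measure_preserving_dig rho nuE).1.

(** Both sides look only at the real coordinate and at the sequence beyond [d], which [dig] merely
    shifts by two. *)
Lemma bang_support_dig (V : set (Xspace R)) x :
  bang_support (bang_support V) (dig rho x) <-> bang_support V x.
Proof. by case: x. Qed.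

Context {Omega : Type}.

Lemma deloc_undig_bang_bang (G : pregraphing R Omega) :
  deloc_graphing undig_aut (bang_graphing (bang_graphing G)) =
  bang_graphing G.
Proof.
rewrite /deloc_graphing/=; apply: eq_pregraphing.
- by rewrite (image_autE undig_aut).
- by apply/funext => e; rewrite (image_lift_autE undig_aut).
- apply/funext => e; apply/funext => -[x d].
  rewrite -[RHS](_ : lift_dialect (undig rho) (lift_dialect (dig rho)
    (bang_map (realiser G e) (x, d))) = _); last first.
    by rewrite /lift_dialect/= digK.
  by rewrite -bang_bang_dig.
Qed.

Lemma deloc_undig_bang_bang_project (a : preproject R Omega) :
  deloc_project undig_aut (bang_project (bang_project a)) = bang_project a.
Proof.
rewrite /deloc_project/=; apply: eq_preproject.
  by rewrite (image_autE undig_aut).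
by apply/funext => i; exact: deloc_undig_bang_bang.
Qed.

Lemma measurable_bang_support (V : set (Xspace R)) :
  measurable V -> measurable (bang_support V).
Proof.
have m1 := @measurable_pop R.
have m2 := measurableT_comp m1 (measurableT_comp measurable_fst m1).
exact: (preimage_measurable (measurableT_comp measurable_fst m2)).
Qed.

Lemma is_project_bang (a : preproject R Omega) :
  is_project (ll rho) a -> is_project (ll rho) (bang_project a).
Proof.
move=> [mS w0 ha]; split=> //; first exact: measurable_bang_support.
move=> i; have [[mG hG] eqS] := ha i; split; last by rewrite /= eqS.
split; first exact: measurable_bang_support.
move=> e; have [ms sS le eS] := hG e; split.
- have m1 := @measurable_pop R.
  have m2 := measurableT_comp m1 (measurableT_comp measurable_fst m1).
  apply: (@preimage_measurable _ _ (Xspace R * I01 R)%type _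
    (@pop2 R \o fst) _ _ ms).
  exact: (measurableT_comp m2 measurable_fst).
- by move=> y /sS[].
- exact: ll_bang.
- move=> _ [y sy <-]; pose w := realiser (@graph _ _ a i) e (pop2 y.1).
  have [Sw _] : (gsupport (@graph _ _ a i) `*` setT) w.
    by apply: eS; exists (pop2 y.1).
  by split=> //; move: Sw; rewrite /bang_support/= -/w; case: w => -[].
Qed.

End digging.

(** Were the preimage under [g] null, pulling it back along [f] would make [S] null. *)
Lemma preimage_gt0 (R : realType) d (T : measurableType d)
    (mu : {measure set T -> \bar R}) (f g : T -> T) (S : set T) :
  null_preserving mu mu f -> measurable_fun setT g -> cancel f g ->
  measurable S -> (0 < mu S)%E -> (0 < mu (g @^-1` S))%E.
Proof.
move=> [mf nf] mg fK mS; rewrite !lt0e !measure_ge0 !andbT.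
apply: contra_neq => gS0; rewrite -[RHS](nf (g @^-1` S)) //.
  by congr (mu _); apply/funext => x; rewrite /preimage/= fK.
exact: preimage_measurable.
Qed.

(** * Execution against a bijection of supports *)

Section transport.
Context {R : realType} {Omega : Type} (one : Omega) (mul : Monoid.law one).
Context (nu : probability (cube R) R) (rho : square_iso R).
Local Notation Y := (Xspace R * I01 R)%type.
Local Notation Z := (Xspace R * I01 R * I01 R)%type.
Local Notation mu := (sf_Z nu).

Context (S1 S2 : set (Xspace R)) (d12 d21 : Xspace R -> Xspace R).
Hypothesis d12K : cancel d12 d21.
Hypothesis d21K : cancel d21 d12.
Hypothesis S12 : forall x, S1 x -> S2 (d12 x).
Hypothesis S21 : forall x, S2 x -> S1 (d21 x).
Hypothesis S1S2 : forall x, S1 x -> S2 x -> False.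

Definition transport : pregraphing R Omega := {|
  gsupport := S1 `|` S2;
  edge := bool;
  source := fun b : bool => (if b then S2 else S1) `*` setT;
  realiser := fun b : bool => lift_dialect (if b then d21 else d12);
  weight := fun=> one |}.

Context (H : pregraphing R Omega).
Hypothesis H_support : gsupport H = S1.
Hypothesis H_source : forall (e : edge H) y, source e y -> S1 y.1.
Hypothesis H_image : forall (e : edge H) y,
  source e y -> S1 (realiser H e y).1.

Local Notation E := (edge transport + edge H)%type.

Lemma cut_transportE x : cut transport H x <-> S1 x.
Proof. by rewrite /cut H_support; split=> [[]//|S1x]; split=> //; left. Qed.

(* From [S1] the transport leads to [S2], where [H] has no edge, hence no
   alternating path can return. *)
Lemma transport_cycle_support (p : seq E) :
  alternating_cycle p -> cycle_support p = set0.
Proof.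
case: p => [[]//|e0 p] [_ cp]; apply/seteqP; split=> // -[[x d] d'] [].
case: e0 cp => [b|e]; case: p => [|[b'|e'] p] //= cp.
- move=> [] [Sb _] [] /= se'; rewrite /preimage/=.
  case: b cp Sb se' => cp Sb se'; last by case: (S1S2 (H_source se') (S12 Sb)).
  have S1w := H_image se'; case: p cp => [_ _|[b|//] p /= cp [] [Sw _]].
    move=> /(congr1 (fun z : Z => z.1.1)) /= wx.
    by move: S1w; rewrite /lift_dialect/= wx => /S1S2; exact.
  case: b cp Sw => cp Sw; first by case: (S1S2 S1w Sw).
  by case: p cp => [//|[//|e2] p cp] [] /H_source/S1S2/(_ (S12 S1w)).
- move=> [] se [] [] Sw _; rewrite /preimage/=.
  have S1w := H_image se; case: b' cp Sw => cp Sw; first by case: (S1S2 S1w Sw).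
  case: p cp => [_ _|[//|e2] p cp].
    move=> /(congr1 (fun z : Z => z.1.1)) /= wx.
    case: (S1S2 (H_source se)) => /=.
    by rewrite -wx; exact: S12.
  by move=> [] /H_source/S1S2/(_ (S12 S1w)).
Qed.

Definition transport_path (e : edge H) : seq E :=
  [:: inl true; inr e; inl false].

Lemma exec_source_transport_path (e : edge H) z :
  exec_source (transport_path e) z <-> source e (d21 z.1.1, z.2).
Proof.
split=> [[[_ [se _]] _ _]//|se].
have S2z : S2 z.1.1 by rewrite -(d21K z.1.1); exact/S12/(H_source se).
have S1w := H_image se.
split.
- by split=> //; split=> //; split.
- by move=> /cut_transportE S1z; exact: S1S2 S1z S2z.
- by move=> /cut_transportE S1z; exact: S1S2 S1z (S12 S1w).
Qed.

(** The cut is [S1], so a path starts and ends in [S2]. Only [d21] starts there; an edge of [H] then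
    stays in [S1], only [d12] leaves it, and back in [S2] no edge of [H] applies. *)
Lemma exec_source_transport (p : seq E) z :
  p != [::] -> sorted (@alternate _ _ transport H) p ->
  exec_source p z -> exists e, p = transport_path e.
Proof.
case: z => [[x d] d']; case: p => // e0 p _ sp [pz /= nS1 nS1'].
have {}nS1 : ~ S1 x by move/cut_transportE.
have {}nS1' : ~ S1 (path_map (e0 :: p) (x, d, d')).1.1 by move/cut_transportE.
case: e0 sp pz nS1' => [[|]|e] sp /= [].
- move=> [S2x _]; case: p sp => [_ _ []|]; first exact: S21.
  case=> [//|e] p /= sp [] se; have S1w := H_image se.
  rewrite /preimage/=; case: p sp => [_ _ []//|[[|]|//] p /= sp [] [] Sw _].
    by have := S1S2 S1w Sw.
  case: p sp => [|[//|e'] p sp]; first by exists e.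
  by move=> [/H_source/=] /S1S2/(_ (S12 S1w)).
- by case.
- by move=> /H_source.
Qed.

Lemma path_weight_transport_path (e : edge H) :
  path_weight mul (transport_path e) = weight H e.
Proof.
by rewrite /path_weight !big_cons big_nil/= !(Monoid.mul1m, Monoid.mulm1).
Qed.

Lemma path_map_transport_path (e : edge H) z :
  path_map (transport_path e) z =
  let w := realiser H e (d21 z.1.1, z.2) in ((d12 w.1, z.1.2), w.2).
Proof. by []. Qed.

Hypothesis d12_null : null_preserving (sf_X nu) (sf_X nu) d12.
Hypothesis d21_null : null_preserving (sf_X nu) (sf_X nu) d21.
Hypothesis mS2 : measurable S2.
Hypothesis H_measurable : forall e : edge H, measurable (source e).
Hypothesis H_null : forall e,
  null_preserving (sf_Y nu) (sf_Y nu) (realiser H e).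
Hypothesis H_inverse : forall e, exists psi,
  [/\ measurable_fun setT psi, cancel (realiser H e) psi &
      cancel psi (realiser H e)].

Lemma null_preserving_lift (f : Xspace R -> Xspace R) :
  null_preserving (sf_X nu) (sf_X nu) f ->
  null_preserving mu mu (fun z : Z => ((f z.1.1, z.1.2), z.2)).
Proof.
move=> fn; exact: (null_preserving_prodl (sf_Y nu) (sf_Y nu) leb01
  (null_preserving_prodl (sf_X nu) (sf_X nu) leb01 fn)).
Qed.

Let second (phi : Y -> Y) (z : Z) : Z :=
  let w := phi (z.1.1, z.2) in ((w.1, z.1.2), w.2).

Let secondE phi : second phi = @swap_dialects R \o
  (fun z => (phi z.1, z.2)) \o @swap_dialects R.
Proof. by []. Qed.

(** [reaching] requires positive measure at each of the three stages. All the sets involved contain,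
    or are preimages under invertible maps of, the source of [e] or that of the restricted path. *)
Lemma transport_path_edge (e : edge H) :
  (0 < mu [set z : Z | source e (z.1.1, z.2)])%E ->
  alternating_path nu (transport_path e) /\
  (0 < mu_XII nu (exec_source (transport_path e)))%E.
Proof.
set A := [set z : Z | _] => A0.
have sw := measure_preserving_swap_dialects nu.
have mA : measurable A.
  exact: (@preimage_measurable _ _ Z Y
    (fst \o @swap_dialects R) _ (measurableT_comp measurable_fst sw.1)).
have es : exec_source (transport_path e) =
    (fun z : Z => ((d21 z.1.1, z.1.2), z.2)) @^-1` A.
  by apply/seteqP; split=> z /exec_source_transport_path.
have mes : measurable (exec_source (transport_path e)).
  by rewrite es; exact: (preimage_measurable (null_preserving_lift d21_null).1).
have pos : (0 < mu (exec_source (transport_path e)))%E.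
  rewrite es; apply: (preimage_gt0 (null_preserving_lift d12_null)) => //.
    exact: (null_preserving_lift d21_null).1.
  by move=> [[x d] d'] /=; rewrite d12K.
pose T0 : E := inl true; pose T1 : E := inr e; pose T2 : E := inl false.
have E1 : step T0 @` (setT `&` step_source T0) `&` step_source T1 = A.
  apply/seteqP; split=> [z []//|[[x d] d'] Az]; split=> //.
  have S1x := H_source Az.
  exists ((d12 x, d), d'); first by do !split; exact: S12.
  by rewrite /= /lift_dialect/= d12K.
have H1 : (0 < mu (setT `&` step_source T0))%E.
  rewrite setTI; apply: (lt_le_trans pos); apply: le_measure; rewrite ?inE.
  - exact: mes.
  - rewrite (_ : step_source T0 = (fst \o fst) @^-1` S2).
      exact: (preimage_measurable
        (measurableT_comp measurable_fst measurable_fst)).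
    by apply/seteqP; split=> z; [case|split].
  - by move=> z [[]].
have H2 : (0 < mu (step T0 @` (setT `&` step_source T0) `&` step_source T1))%E.
  by rewrite E1.
have H3 : (0 < mu (step T1 @` (step T0 @` (setT `&` step_source T0) `&`
    step_source T1) `&` step_source T2))%E.
  have [psi [mpsi psiK Kpsi]] := H_inverse e.
  (* The image of [A] under an invertible step is its preimage under the inverse step, and it
     already lies over [S1], the source of the last edge. *)
  rewrite E1 (_ : _ `&` _ = second psi @^-1` A).
    apply: (@preimage_gt0 _ _ _ mu (second (realiser H e))) => //.
    - rewrite secondE.
      exact: (null_preserving_comp (measure_preserving_null sw)
        (null_preserving_comp (null_preserving_prodl (sf_Y nu) (sf_Y nu) leb01
        (H_null e)) (measure_preserving_null sw))).
    - have mp : measurable_fun setT (fun z : Z => (psi z.1, z.2)).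
        apply: measurable_fun_pair => //.
        exact: (measurableT_comp mpsi measurable_fst).
      exact: (measurableT_comp sw.1 (measurableT_comp mp sw.1)).
    - by move=> [[x d] d']; rewrite /second/= -surjective_pairing psiK.
  apply/seteqP; split.
    move=> _ [[[[x d] d'] Az <-] _]; rewrite /preimage/A/second/=.
    by rewrite -!surjective_pairing psiK.
  move=> [[x d] d']; rewrite /preimage/A/second/= -surjective_pairing => Az.
  split.
    exists (second psi ((x, d), d')).
      by rewrite /A/second/= -surjective_pairing.
    by rewrite /step/=/second/= -surjective_pairing Kpsi.
  by split=> //=; have := H_image Az; rewrite Kpsi.
split; last exact: pos.
split; [by []|by []|exact: (conj H1 (conj H2 (conj H3 Logic.I)))].
Qed.

End transport.

(** * Digging *)

Section digging_exec.
Context {R : realType} {Omega : Type} (one : Omega) (mul : Monoid.law one).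
Context (nu : probability (cube R) R) (rho : square_iso R).
Context (m : Omega -> \bar R).
Hypothesis nuE : cube_lebesgue nu.
Hypothesis m_ge0 : forall w, (0 <= m w)%E.
Local Notation Y := (Xspace R * I01 R)%type.
Local Notation Z := (Xspace R * I01 R * I01 R)%type.
Local Notation mu := (sf_Z nu).

Context (V : set (Xspace R)) (theta1 theta2 : borel_aut R).
Hypothesis mV : measurable V.
Hypothesis theta1_nonsingular : nonsingular nu theta1.
Hypothesis theta2_nonsingular : nonsingular nu theta2.
Hypothesis disjoint_supports : (theta1 @` bang_support V) `&`
  (theta2 @` bang_support (bang_support V)) = set0.

Local Notation V1 := (bang_support V).
Local Notation V2 := (bang_support V1).
Local Notation S1 := (theta1 @` V1).
Local Notation S2 := (theta2 @` V2).

Definition dig_deloc x := theta2 (dig rho (aut_inv theta1 x)).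
Definition undig_deloc x := theta1 (undig rho (aut_inv theta2 x)).

Lemma dig_delocK : cancel dig_deloc undig_deloc.
Proof. by move=> x; rewrite /undig_deloc/dig_deloc aut_mapK digK aut_invK. Qed.

Lemma undig_delocK : cancel undig_deloc dig_deloc.
Proof.
by move=> x; rewrite /undig_deloc/dig_deloc aut_mapK undigK aut_invK.
Qed.

Lemma dig_deloc_support x : S1 x -> S2 (dig_deloc x).
Proof.
rewrite !image_autE /preimage/= /dig_deloc aut_mapK => V1x.
exact: (bang_support_dig rho V _).2.
Qed.

Lemma undig_deloc_support x : S2 x -> S1 (undig_deloc x).
Proof.
rewrite !image_autE /preimage/= /undig_deloc aut_mapK => V2x.
by apply: (bang_support_dig rho V _).1; rewrite undigK.
Qed.

Lemma disjointP x : S1 x -> S2 x -> False.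
Proof.
by move=> S1x S2x; have : (S1 `&` S2) x by []; rewrite disjoint_supports.
Qed.

Lemma null_preserving_dig_deloc :
  null_preserving (sf_X nu) (sf_X nu) dig_deloc.
Proof.
have [_ n1] := nonsingular_null_preserving theta1_nonsingular.
have [n2 _] := nonsingular_null_preserving theta2_nonsingular.
exact: (null_preserving_comp n2 (null_preserving_comp
  (measure_preserving_null (measure_preserving_dig rho nuE)) n1)).
Qed.

Lemma null_preserving_undig_deloc :
  null_preserving (sf_X nu) (sf_X nu) undig_deloc.
Proof.
have [n1 _] := nonsingular_null_preserving theta1_nonsingular.
have [_ n2] := nonsingular_null_preserving theta2_nonsingular.
exact: (null_preserving_comp n1 (null_preserving_comp
  (measure_preserving_null (measure_preserving_undig rho nuE)) n2)).
Qed.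

Let mS1 : measurable S1.
Proof. by apply: measurable_image_aut; exact: measurable_bang_support. Qed.

Let mS2 : measurable S2.
Proof.
apply: measurable_image_aut; apply: measurable_bang_support.
exact: measurable_bang_support.
Qed.

Definition dig_graphing : pregraphing R Omega :=
  transport one S1 S2 dig_deloc undig_deloc.

Definition dig_project : preproject R Omega := {|
  psupport := S1 `|` S2;
  wager := 0%E;
  slice := unit;
  coef := fun=> 1;
  graph := fun=> dig_graphing |}.

Lemma is_project_dig :
  is_project (deloc_microcosm rho theta1 theta2) dig_project.
Proof.
have mS : measurable (S1 `|` S2) by exact: measurableU.
split=> //= _; split=> //; split=> // -[] /=; split.
- by apply: measurableX.
- by move=> y [Sy _]; split=> //; right.
- rewrite (_ : lift_dialect _ = lift_dialect theta1 \o
    (lift_dialect (undig rho) \o lift_dialect (aut_inv theta2)))//.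
  apply: monoid_gen_comp; last apply: monoid_gen_comp; apply: monoid_gen_in.
  + by left; left; left; right.
  + by left; left; left; left; exact: ll_undig.
  + by right.
- by move=> _ [y [Sy _] <-]; split=> //; left; exact: undig_deloc_support.
- by apply: measurableX.
- by move=> y [Sy _]; split=> //; left.
- rewrite (_ : lift_dialect _ = lift_dialect theta2 \o
    (lift_dialect (dig rho) \o lift_dialect (aut_inv theta1)))//.
  apply: monoid_gen_comp; last apply: monoid_gen_comp; apply: monoid_gen_in.
  + by left; right.
  + by left; left; left; left; exact: ll_dig.
  + by left; left; right.
- by move=> _ [y [Sy _] <-]; split=> //; right; exact: dig_deloc_support.
Qed.

Section graphing.
Context (G : pregraphing R Omega).
Hypothesis llG : is_graphing (ll rho) G.
Hypothesis supportG : gsupport G = V1.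

Local Notation H := (deloc_graphing theta1 G).

Let H_support : gsupport H = S1. Proof. by rewrite /= supportG. Qed.

Let H_source (e : edge H) y : source e y -> S1 y.1.
Proof.
move=> [w se <-]; have [_ /(_ e)[_ /(_ w se)[Sw _] _ _]] := llG.
by exists w.1 => //; rewrite -supportG.
Qed.

Let H_image (e : edge H) y : source e y -> S1 (realiser H e y).1.
Proof.
move=> [w se <-]; have [_ /(_ e)[_ _ _ h]] := llG.
have [Sw _] : (gsupport G `*` setT) (realiser G e w) by apply: h; exists w.
exists (realiser G e w).1; first by rewrite -supportG.
by rewrite /= /lift_dialect/= aut_mapK -surjective_pairing.
Qed.

Let H_measurable (e : edge H) : measurable (source e).
Proof.
rewrite /= image_lift_autE; have [_ /(_ e)[ms _ _ _]] := llG.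
apply: preimage_measurable ms.
by apply: measurable_lift_dialect; exact: measurable_aut_inv.
Qed.

Let lift_null f : null_preserving (sf_X nu) (sf_X nu) f ->
  null_preserving (sf_Y nu) (sf_Y nu) (lift_dialect f).
Proof. exact: (null_preserving_prodl (sf_X nu) (sf_X nu) leb01). Qed.

Let H_null e : null_preserving (sf_Y nu) (sf_Y nu) (realiser H e).
Proof.
have [n1 n1'] := nonsingular_null_preserving theta1_nonsingular.
have [_ /(_ e)[_ _ /(null_preserving_ll nuE) le _]] := llG.
exact: (null_preserving_comp (null_preserving_comp (lift_null n1) le)
  (lift_null n1')).
Qed.

Let H_inverse e : exists psi, [/\ measurable_fun setT psi,
  cancel (realiser H e) psi & cancel psi (realiser H e)].
Proof.
have [n1 n1'] := nonsingular_null_preserving theta1_nonsingular.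
have [_ /(_ e)[_ _ /ll_inv[psi [lpsi psiK Kpsi]] _]] := llG.
have := null_preserving_ll nuE lpsi => npsi.
have liftK : cancel (lift_dialect theta1) (lift_dialect (aut_inv theta1)).
  by move=> [x d]; rewrite /lift_dialect/= aut_mapK.
have liftK' : cancel (lift_dialect (aut_inv theta1)) (lift_dialect theta1).
  by move=> [x d]; rewrite /lift_dialect/= aut_invK.
exists (lift_dialect theta1 \o psi \o lift_dialect (aut_inv theta1)); split.
- exact: (null_preserving_comp (null_preserving_comp (lift_null n1) npsi)
    (lift_null n1')).1.
- by move=> y /=; rewrite liftK psiK liftK'.
- by move=> y /=; rewrite liftK Kpsi liftK'.
Qed.

Lemma measurement_dig_deloc : measurement mul nu m dig_graphing H = 0%E.
Proof.
apply: esum1 => p ap.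
rewrite (transport_cycle_support dig_deloc_support disjointP H_source
  H_image)//.
by rewrite integral_set0 mule0.
Qed.

Local Notation dig_exec := (exec mul nu rho dig_graphing H).
Local Notation G1 := (deloc_graphing (aut_sym theta2) dig_exec).

Lemma dig_exec_edge (p : edge dig_exec) :
  exists e : edge G, sval p =
    transport_path one S1 S2 dig_deloc undig_deloc (e : edge H).
Proof.
case: p => p /= /asboolP[[p0 sp _] pos].
have [z ez] : exists z, exec_source p z.
  apply: contrapT => /forallNP h; move: pos.
  rewrite (_ : exec_source p = set0) ?mu_XIIE ?measure0 ?ltxx//.
  by apply/seteqP; split=> z // /h.
exact: (exec_source_transport dig_deloc_support undig_deloc_support disjointP
  H_support H_source H_image p0 sp ez).
Qed.

(** The edge of [G] in the middle of the path. It determines the path, so edges of the execution can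
    be identified with certain edges of [G]. *)
Definition exec_mid (p : edge dig_exec) : edge G :=
  sval (cid (dig_exec_edge p)).

Lemma exec_midP (p : edge dig_exec) : sval p =
  transport_path one S1 S2 dig_deloc undig_deloc (exec_mid p : edge H).
Proof. exact: (svalP (cid (dig_exec_edge p))). Qed.

Lemma exec_mid_inj : injective exec_mid.
Proof.
by move=> p q pq; apply: val_inj; rewrite /= exec_midP pq -exec_midP.
Qed.

Lemma source_exec (p : edge G1) y : source p y <->
  source (exec_mid p) (undig rho y.1, (sq_inv rho y.2).2).
Proof.
case: y => x d.
have -> : source p = lift_dialect (aut_sym theta2) @`
    (split_dialects rho @^-1` exec_source (sval p)) by [].
rewrite exec_midP image_lift_autE.
apply: (iff_trans (exec_source_transport_path one undig_delocK dig_deloc_support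
  disjointP H_support H_source H_image _ _)).
apply: (iff_trans (image_lift_autP theta1 _ _)).
by rewrite /lift_dialect/= /undig_deloc !aut_mapK.
Qed.

(** Undoing [theta2] cancels both delocations, which is why [G1] is again a graphing in [ll]
    although [theta1] and [theta2] may lie outside it. *)
Lemma realiser_exec (p : edge G1) : realiser G1 p = lift_dialect (dig rho) \o
  second_dialect rho (realiser G (exec_mid p)) \o lift_dialect (undig rho).
Proof.
apply/funext => -[x d]; rewrite /= exec_midP path_map_transport_path.
rewrite /lift_dialect/merge_dialects/second_dialect/=.
by rewrite /dig_deloc/undig_deloc !aut_mapK /lift_dialect/= aut_mapK.
Qed.

Lemma gsupport_exec : gsupport G1 = V2.
Proof.
have -> : gsupport G1 = aut_sym theta2 @` S2.
  congr (_ @` _); apply/seteqP; split=> x.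
    move=> [[[S1x|//] ncut]|[/= Hx ncut]]; case: ncut.
      exact/(cut_transportE one S2 dig_deloc undig_deloc H_support).
    split=> //; left; by rewrite -H_support.
  move=> S2x; left; split; first by right.
  move=> /(cut_transportE one S2 dig_deloc undig_deloc H_support) S1x.
  exact: disjointP S1x S2x.
rewrite image_autE image_autE; apply/funext => x.
by rewrite /preimage/= aut_mapK.
Qed.

Lemma is_graphing_exec : is_graphing (ll rho) G1.
Proof.
split.
  rewrite gsupport_exec; apply: measurable_bang_support.
  exact: measurable_bang_support.
rewrite gsupport_exec => p; have [_ /(_ (exec_mid p))[ms sS le eS]] := llG.
rewrite supportG in sS eS; split.
- pose g (y : Y) : Y := (undig rho y.1, (sq_inv rho y.2).2).
  have -> : source p = g @^-1` source (exec_mid p).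
    by apply/seteqP; split=> y /source_exec.
  apply: preimage_measurable ms; apply: measurable_fun_pair.
    exact: (measurableT_comp (measure_preserving_undig rho nuE).1
      measurable_fst).
  exact: (measurableT_comp measurable_snd
    (measurableT_comp (measurable_sq_inv rho) measurable_snd)).
- by move=> y /source_exec/sS[V1y _]; split.
- rewrite realiser_exec; apply: ll_comp; last exact: ll_undig.
  by apply: ll_comp; [exact: ll_dig|exact: ll_second_dialect].
- move=> _ [y /source_exec sy <-]; rewrite realiser_exec; split=> //.
  set w := (undig rho y.1, _) in sy.
  have [V1w _] : (V1 `*` setT) (realiser G (exec_mid p) w).
    by apply: eS; exists w.
  exact: (bang_support_dig rho V _).2.
Qed.

Lemma exec_mid_range (e : edge G) :
  (0 < mu [set z : Z | source e z.1])%E -> exists p, exec_mid p = e.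
Proof.
move=> e0.
have [n1 n1'] := nonsingular_null_preserving theta1_nonsingular.
have sw := measure_preserving_swap_dialects nu.
have pos : (0 < mu [set z : Z | @source _ _ H e (z.1.1, z.2)])%E.
  (* The dialect of [G] is the first one when [G] is measured against a test, but the second one in
     the execution, hence the swap. *)
  pose f z := (fun z : Z => ((theta1 z.1.1, z.1.2), z.2)) (swap_dialects z).
  pose g z := swap_dialects
    ((fun z : Z => ((aut_inv theta1 z.1.1, z.1.2), z.2)) z).
  have -> : [set z : Z | @source _ _ H e (z.1.1, z.2)] =
      g @^-1` [set z : Z | source e z.1].
    apply/funext => z; apply/propext.
    exact: (image_lift_autP theta1 (source e) (z.1.1, z.2)).
  apply: (@preimage_gt0 _ _ _ mu f g).
  - exact: (null_preserving_comp (null_preserving_lift n1)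
      (measure_preserving_null sw)).
  - exact: (null_preserving_comp (measure_preserving_null sw)
      (null_preserving_lift n1')).1.
  - by move=> [[x d] d']; rewrite /f/g/swap_dialects/= aut_mapK.
  - have [_ /(_ e)[ms _ _ _]] := llG.
    exact: (@preimage_measurable _ _ Z Y fst _ measurable_fst ms).
  - exact: e0.
have := transport_path_edge one dig_delocK undig_delocK dig_deloc_support
  disjointP H_support H_source H_image null_preserving_dig_deloc
  null_preserving_undig_deloc mS2 H_measurable H_null H_inverse pos.
move=> /asboolP h.
pose is_edge (p : seq (edge dig_graphing + edge H)) : Prop :=
  `[< alternating_path nu p /\ (0 < mu_XII nu (exec_source p))%E >].
pose p : edge dig_exec := exist is_edge
  (transport_path one S1 S2 dig_deloc undig_deloc (e : edge H)) h.
by exists p; have [<-] := exec_midP p.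
Qed.

(** The half of the dialect that is forgotten has total mass 1, so the idle dialect leaves
    measurements unchanged. *)
Lemma measure_preserving_split :
  measure_preserving (@leb01 R) (@leb01 R) (fun d => (sq_inv rho d).2).
Proof.
have inv : measure_preserving leb01 (leb01 \x leb01)%E (sq_inv rho).
  apply: (@measure_preserving_inv R _ _ _ _ (leb01 \x leb01)%E leb01 rho).
  - by split; [exact: measurable_sq_map|exact: sq_map_preserving].
  - exact: measurable_sq_inv.
  - exact: sq_mapK.
apply: (measure_preserving_comp _ inv); split=> // S mS.
rewrite (_ : snd @^-1` S = setT `*` S); last first.
  by apply/seteqP; split=> -[] // ? ? [].
rewrite product_measure1E// [X in (X * _)%E](_ : _ = 1%E) ?mul1e//.
exact: probability_setT.
Qed.

(** Transfer where [h] sends a path to its middle edge, [pi] undoes [dig] and forgets the idle half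
    of the merged dialect, and [kappa] records that half. *)
Lemma measurement_exec (T : pregraphing R Omega) : is_graphing (ll rho) T ->
  measurement mul nu m G1 T =
  measurement mul nu m G (deloc_graphing (undig_aut rho nuE) T).
Proof.
move=> llT; pose T' := deloc_graphing (undig_aut rho nuE) T.
have llT' : is_graphing (ll rho) T'.
  by apply: is_graphing_deloc llT; [exact: ll_undig|exact: ll_dig].
pose h (e : edge G1 + edge T) : edge G + edge T' :=
  match e with inl p => inl (exec_mid p) | inr e => inr e end.
pose pi (z : Z) : Z := ((undig rho z.1.1, (sq_inv rho z.1.2).2), z.2).
pose kappa (z : Z) := (sq_inv rho z.1.2).1.
have reg := regular_graphings nuE llG llT'.
have h_inj : injective h.
  by move=> [p|e] [q|e'] //= [] => [/exec_mid_inj|] ->.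
apply: (@measurement_transfer _ _ _ mul nu m m_ge0 G1 T G T' h pi _ kappa reg
  h_inj).
- by move=> [p|e] [q|e'].
- by move=> [p|//] /=; rewrite exec_midP path_weight_transport_path.
- move=> [p|e] [[x d] d'].
    exact: (source_exec p (x, d)).
  have := image_lift_autP (undig_aut rho nuE) (@source _ _ T e)
    (undig rho x, d').
  by rewrite /lift_dialect/= undigK => ->.
- move=> [p|e] [[x d] d'].
    have -> : step (inl p : edge G1 + edge T) (x, d, d') =
      (realiser G1 p (x, d), d') by [].
    rewrite realiser_exec /pi/= digK sq_mapK/=.
    by rewrite -surjective_pairing.
  by rewrite /pi/= /lift_dialect/= undigK.
- move=> [p|e] [[x d] d'] //.
  have -> : step (inl p : edge G1 + edge T) (x, d, d') =
    (realiser G1 p (x, d), d') by [].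
  by rewrite realiser_exec /kappa/= sq_mapK.
- move=> [[x d] d'] [[y c] c'] pq dc1.
  have /= xy := congr1 (fun z : Z => z.1.1) pq.
  have /= dc2 := congr1 (fun z : Z => z.1.2) pq.
  have /= dc' := congr1 (fun z : Z => z.2) pq.
  rewrite /kappa/= in dc1; congr (_, _, _); last exact: dc'.
    by rewrite -(undigK rho x) xy undigK.
  rewrite -(sq_invK rho d) -(sq_invK rho c).
  by rewrite (surjective_pairing (sq_inv rho d)) dc1 dc2 -surjective_pairing.
- exact: (measure_preserving_prodl (sf_Y nu) (sf_Y nu) leb01
    (measure_preserving_comp
      (measure_preserving_prodl (sf_X nu) (sf_X nu) leb01
        (measure_preserving_undig rho nuE))
      (measure_preserving_prodr leb01 leb01 (sf_X nu)
        measure_preserving_split))).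
(* An edge of [G] that yields no edge of the execution has a null source, by contraposition of
   [exec_mid_range]. *)
- move=> [e|e] he; last by case: he; exists (inr e).
  apply: contrapT => /eqP e0; apply: he.
  have [p <-] : exists p, exec_mid p = e.
    by apply: exec_mid_range; rewrite lt0e e0 measure_ge0.
  by exists (inl p).
Qed.

End graphing.
End digging_exec.

(** * From graphings to projects *)

Section digging_project.
Context {R : realType} {Omega : Type} (one : Omega) (mul : Monoid.law one).
Context (nu : probability (cube R) R) (rho : square_iso R).
Context (m : Omega -> \bar R).
Hypothesis nuE : cube_lebesgue nu.
Hypothesis m_ge0 : forall w, (0 <= m w)%E.
Context (V : set (Xspace R)) (theta1 theta2 : borel_aut R).
Hypothesis mV : measurable V.
Hypothesis theta1_nonsingular : nonsingular nu theta1.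
Hypothesis theta2_nonsingular : nonsingular nu theta2.
Hypothesis disjoint_supports : (theta1 @` bang_support V) `&`
  (theta2 @` bang_support (bang_support V)) = set0.

Local Notation V1 := (bang_support V).
Local Notation V2 := (bang_support V1).
Local Notation f := (dig_project one rho V theta1 theta2).

Context (b : preproject R Omega).
Hypothesis b_project : is_project (ll rho) b.
Hypothesis b_support : psupport b = V1.

Local Notation g := (deloc_project (aut_sym theta2)
  (exec_project mul nu m rho f (deloc_project theta1 b))).

Let graphb (i : slice b) :
  is_graphing (ll rho) (graph i) /\ gsupport (graph i) = V1.
Proof. by have [_ _ /(_ i)] := b_project; rewrite b_support. Qed.

(** Cycles with the transport have empty support, so the only term left is the wager of [b] times
    the single coefficient 1. *)
Lemma wager_dig_exec :
  interaction mul nu m f (deloc_project theta1 b) = wager b.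
Proof.
rewrite /interaction /= mul0e add0e [X in (_ + X)%E]big1 ?adde0; last first.
  move=> i _; rewrite big1// => j _.
  rewrite measurement_dig_deloc ?mule0//; first exact: (graphb j).1.
  exact: (graphb j).2.
have -> : total_coef f = 1 by rewrite /total_coef big_const card_unit /= addr0.
(* Nonnegativity of the wager excludes [-oo], the only value that [absorb] changes. *)
rewrite mule1; have [_ + _] := b_project; rewrite /absorb.
by case: (wager b).
Qed.

Lemma psupport_dig_exec : psupport g = V2.
Proof.
rewrite /= b_support (_ : _ `|` _ = theta2 @` V2).
  rewrite (image_autE (aut_sym theta2)) image_autE; apply/funext => x.
  by rewrite /preimage/= aut_mapK.
apply/seteqP; split=> x; last first.
  move=> S2x; left; split; first by right.
  by move=> S1x; exact: (disjointP disjoint_supports S1x S2x).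
by move=> [[[S1x|//] []//]|[S1x []]]; left.
Qed.

Lemma is_project_dig_exec : is_project (ll rho) g.
Proof.
have [_ w0 _] := b_project; split.
- rewrite psupport_dig_exec; apply: measurable_bang_support.
  exact: measurable_bang_support.
- by rewrite /= wager_dig_exec.
- move=> [u i]; have [lb sb] := graphb i; rewrite psupport_dig_exec; split.
    exact: is_graphing_exec.
  exact: gsupport_exec.
Qed.

Lemma sum_unit_pair (I : finType) (F : unit * I -> \bar R) :
  (\sum_(p : unit * I) F p = \sum_(i : I) F (tt, i))%E.
Proof.
rewrite (reindex (fun i : I => (tt, i)))//.
by exists snd => [//|[[] i]].
Qed.

Lemma interaction_dig_exec (t : preproject R Omega) :
  is_project (ll rho) t ->
  interaction mul nu m g t =
  interaction mul nu m b (deloc_project (undig_aut rho nuE) t).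
Proof.
move=> [_ _ ht].
have wg : wager g = wager b by exact: wager_dig_exec.
have tg : total_coef g = total_coef b.
  rewrite /total_coef (reindex (fun i : slice b => (tt, i)))/=; last first.
    by exists snd => [//|[[] i]].
  by apply: eq_bigr => i _; rewrite mul1r.
rewrite /interaction wg tg; congr absorb; congr (_ + _)%E.
rewrite [LHS]sum_unit_pair; apply: eq_bigr => i _; apply: eq_bigr => j _ /=.
have [lb sb] := graphb i.
by rewrite mul1r measurement_exec//; exact: (ht j).1.
Qed.

End digging_project.

Theorem theorem3 (R : realType) (rho : square_iso R)
    (nu : probability (cube R) R) (nu_lebesgue : cube_lebesgue nu)
    (d : measure_display) (Omega : measurableType d)
    (one : Omega) (mul : Monoid.law one)
    (m : Omega -> \bar R) (m_ge0 : forall w, (0 <= m w)%E)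
    (m_measurable : measurable_fun setT m)
    (V : set (Xspace R)) (A : preproject R Omega -> Prop)
    (A_conduct : conduct mul nu m rho V A)
    (theta1 theta2 : borel_aut R)
    (theta1_nonsingular : nonsingular nu theta1)
    (theta2_nonsingular : nonsingular nu theta2)
    (disjoint_supports : (theta1 @` bang_support V) `&`
      (theta2 @` bang_support (bang_support V)) = set0) :
  exists f : preproject R Omega,
    lollipop mul nu m rho (deloc_microcosm rho theta1 theta2)
      (theta1 @` bang_support V) (theta2 @` bang_support (bang_support V))
      (deloc theta1 (bang mul nu m rho V A))
      (deloc theta2
        (bang mul nu m rho (bang_support V) (bang mul nu m rho V A))) f.
Proof.
have [mV A_project _] := A_conduct.
exists (dig_project one rho V theta1 theta2); split=> //.
  exact: is_project_dig.
move=> _ [b [[b_project b_support b_orth] ->]].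
eexists; split; last exact/esym/deloc_project_aut_symK.
split.
- exact: is_project_dig_exec.
- exact: psupport_dig_exec.
move=> t [t_project t_support t_orth].
pose undig := undig_aut rho nu_lebesgue.
have ll1 : ll rho (lift_dialect undig) by exact: ll_undig.
have ll2 : ll rho (lift_dialect (aut_inv undig)) by exact: ll_dig.
have undig_support : undig @` bang_support (bang_support V) = bang_support V.
  by rewrite image_autE.
have t'_project := is_project_deloc ll1 ll2 t_project.
have [] : orthogonal_projects mul nu m b (deloc_project undig t).
  apply: b_orth; split=> //; first by rewrite /= t_support.
  move=> _ [a [Aa a_balanced ->]].
  have [a_project a_support] := A_project a Aa.
  have b1 := is_project_bang a_project.
  have b2 := is_project_bang b1.
  have [] : orthogonal_projects mul nu m t (bang_project (bang_project a)).
    (* [!a] has wager 0 by construction and lies in the biorthogonal [!A], so [!!a] is among the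
       generators of [!!A]. *)
    apply: t_orth; exists (bang_project a); split=> //; split=> //.
      by rewrite /= a_support.
    move=> u [u_project u_support u_orth].
    apply: (orthogonal_sym nu_lebesgue m_ge0 u_project b1).
    by apply: u_orth; exists a.
  rewrite -(interaction_deloc mul nu_lebesgue m_ge0 (theta := undig)
    (measure_preserving_dig rho nu_lebesgue) t_project b2).
  rewrite deloc_undig_bang_bang_project => _ i0 ioo; split=> //.
  by rewrite /= t_support undig_support a_support.
rewrite -(interaction_dig_exec mul nu_lebesgue m_ge0 mV theta1_nonsingular
  theta2_nonsingular disjoint_supports b_project b_support t_project).
move=> _ i0 ioo; split=> //.
by rewrite psupport_dig_exec.
Qed.
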